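(* A finitely presented rack $\mathcal R=\langle S\mid R\rangle$ is finite if and only if there is a positive integer $M$ such that ENUMERATE$(S,R,M)$ completes.
   Context: RACKS AND PRESENTATIONS. A rack is a set with two binary operations $\rhd,\rhd^{-1}$ such that $(x\rhd y)\rhd^{-1}y=(x\rhd^{-1}y)\rhd y=x$ and $(x\rhd y)\rhd z=(x\rhd z)\rhd(y\rhd z)$ for all $x,y,z$. Write $x^y=x\rhd y$, $x^{\bar y}=x\rhd^{-1}y$; a word in the exponent acts letter by letter from left to right. $F(S)$ is the free group on $S$, and $\bar w$ denotes the inverse of $w\in F(S)$; $\bar S=\{\bar x: x\in S\}$. The free rack $FR(S)$ is the set of symbols $a^w$ ($a\in S$, $w\in F(S)$), with $a^u=b^v$ iff $a=b$ in $S$ and $u=v$ in $F(S)$, and operations $a^u\rhd b^v=a^{u\bar v b v}$, $a^u\rhd^{-1}b^v=a^{u\bar v\bar b v}$. Given $S=\{x_1,\dots,x_g\}$ ($g\ge1$) and a finite set $R$ of pairs $(x_i^{u},x_j)$, written $x_i^u=x_j$, with $x_i,x_j\in S$ and $u$ a reduced word in $F(S)$ (primary relations), $\mathcal R=\langle S\mid R\rangle$ is the quotient of $FR(S)$ by the smallest congruence (equivalence relation respecting both operations) containing $R$. TABLES. An enumeration table for $\mathcal R$ is $\mathcal E=(\omega,A,\tau,\rho)$, where $\omega$ is the number of rows, $A$ is a partial function $\{1,\dots,\omega\}\times(S\cup\bar S)\to\{1,\dots,\omega\}$ (write $i^y$ for $A(i,y)$, possibly undefined), $\tau:\{1,\dots,\omega\}\to\mathcal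 R$ and $\rho:\{1,\dots,\omega\}\to\{1,\dots,\omega\}$ are functions, and $\rho(i)\le i$ for all $i$. The live elements are $\Omega=\{i:\rho(i)=i\}$ (always with respect to the current $\rho$). REP$(i)$ is the least element of $\{\rho^t(i):t\ge0\}$, obtained by iterating $\rho$ until a fixed point is reached. ALGORITHMS (all act on the current table; loops over $R$, $R_2$, $S\cup\bar S$ use fixed orders, not depending on $M$). INIT: $\omega:=g$, $A$ empty, $\tau(i):=x_i$ and $\rho(i):=i$ for $1\le i\le g$; $R_2$ (secondary relations) is the set of reduced forms of the words $\bar u x_i u\bar x_j$ for $x_i^u=x_j$ in $R$. DEFINE$(i,y)$: $\omega:=\omega+1$; $i^y:=\omega$; $\omega^{\bar y}:=i$; $\tau(\omega):=\tau(i)^y$; $\rho(\omega):=\omega$. DEDUCTION$(i,y,j)$: $i^y:=j$; $j^{\bar y}:=i$. SCAN$(i,w,j)$ with $w=y_1\cdots y_t$ reduced: set $f:=1$, $b:=t$, $k:=i$, $\ell:=j$. Repeat: while $f\le b$ and $k^{y_f}$ is defined, set $k:=k^{y_f}$, $f:=f+1$; then while $f\le b$ and $\ell^{\bar y_b}$ is defined, set $\ell:=\ell^{\bar y_b}$, $b:=b-1$. If $f<b$, call DEFINE$(k,y_f)$ and repeat; if $f=b$, call DEDUCTION$(k,y_f,\ell)$ and stop; if $f>b$ and $k\ne\ell$, call COINCIDENCE$(k,\ell)$ and stop; if $f>b$ and $k=\ell$, stop. UPDATE$(i)$: set $\rho(j):=$ REP$(i)$ for all $j$ in $\{\rho^t(i):t\ge0\}$.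 MERGE$(m,n)$ (with a queue $Q$): $\mu:=$ REP$(m)$, $\nu:=$ REP$(n)$; if $\mu\ne\nu$, append $\max(\mu,\nu)$ to $Q$ and set $\rho(\max(\mu,\nu)):=\min(\mu,\nu)$. COINCIDENCE$(m,n)$: let $Q$ be empty; call MERGE$(m,n)$. Process the elements $d$ of $Q$ in order (including those appended meanwhile) until all are processed: for each $x\in S\cup\bar S$, if $d^x$ is defined, say $d^x=e$, then: undefine $d^x$ and $e^{\bar x}$; set $\delta:=$ REP$(d)$, UPDATE$(d)$; $\epsilon:=$ REP$(e)$, UPDATE$(e)$; if $\delta^x$ is defined, MERGE$(\epsilon,\delta^x)$; else if $\epsilon^{\bar x}$ is defined, MERGE$(\delta,\epsilon^{\bar x})$; else set $\delta^x:=\epsilon$, $\epsilon^{\bar x}:=\delta$. ENUMERATE$(S,R,M)$: run INIT. For each $x_i^u=x_j$ in $R$, call SCAN$($REP$(i),u,$REP$(j))$. Set $i:=1$. While $i\le\max(\Omega)$ and $i\le M$: (1) for each $w\in R_2$, if $i\in\Omega$ call SCAN$(i,w,i)$, otherwise break off this loop; (2) if $i\in\Omega$, for each $y\in S\cup\bar S$ with $i^y$ undefined call DEFINE$(i,y)$; (3) $i:=i+1$. After the loop, if $i>\max(\Omega)$ return $\mathcal E$ (then the process is said to complete); otherwise return ''run limit exceeded''. *)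

(* Defs.v *)
From HB Require Import structures.
From mathcomp Require Import all_boot.
From mathcomp Require Import boolp classical_sets cardinality.

Set Implicit Arguments.
Unset Strict Implicit.
Unset Printing Implicit Defensive.

Reserved Notation "x |> y" (at level 40, left associativity).
Reserved Notation "x |>^-1 y" (at level 40, left associativity).

HB.mixin Record isRack T := {
  rop : T -> T -> T;
  ropV : T -> T -> T;
  ropK : forall x y, ropV (rop x y) y = x;
  ropVK : forall x y, rop (ropV x y) y = x;
  ropD : forall x y z, rop (rop x y) z = rop (rop x z) (rop y z)
}.

#[short(type="rackType")]
HB.structure Definition Rack := {T of isRack T}.

Notation "x |> y" := (rop x y).
Notation "x |>^-1 y" := (ropV x y).

(* The generators are x_1, ..., x_g, with x_(i+1) encoded as i : 'I_g.        *)
(* The letter (s, false) is s and the letter (s, true) is its inverse.        *)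
Notation letter g := ('I_g * bool)%type.

Definition linv g (y : letter g) : letter g := (y.1, ~~ y.2).

Lemma linvK g : involutive (@linv g).
Proof. by case=> s b; rewrite /linv negbK. Qed.

Section FreeGroup.
Context {g : nat}.
Implicit Types (y z : letter g) (u v w : seq (letter g)).

Definition reduced w : bool := sorted (fun y z => z != linv y) w.

Definition push y w :=
  if w is z :: w' then if z == linv y then w' else y :: w else [:: y].

Definition reduce w : seq (letter g) := foldr push [::] w.

Definition winv w : seq (letter g) := rev (map (@linv g) w).

Lemma winvK : involutive winv.
Proof.
by move=> w; rewrite /winv map_rev revK -map_comp -[RHS]map_id; apply: eq_map => y /=;
  rewrite linvK.
Qed.

Lemma push_reduced y w : reduced w -> reduced (push y w).
Proof.
case: w => [|z w] //= ew; have [_|ne] := eqVneq; first exact: path_sorted ew.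
by rewrite /= ne.
Qed.

Lemma reduced_foldr u v : reduced v -> reduced (foldr push v u).
Proof. by move=> rv; elim: u => //= y u; apply: push_reduced. Qed.

Lemma reduce_reduced w : reduced (reduce w).
Proof. exact: reduced_foldr. Qed.

Lemma reduce_id w : reduced w -> reduce w = w.
Proof.
elim: w => //= y w IH ew; rewrite IH; last exact: path_sorted ew.
by case: w ew {IH} => //= z w /andP[/negPf-> _].
Qed.

Lemma pushK y w : reduced w -> push (linv y) (push y w) = w.
Proof.
case: w => [|z w] /=; first by rewrite linvK eqxx.
have [->|ne] := eqVneq; last by rewrite /= linvK eqxx.
by case: w => //= t w /andP[/negPf->].
Qed.

Lemma pushVK y w : reduced w -> push y (push (linv y) w) = w.
Proof. by move=> rw; rewrite -{1}[y]linvK pushK. Qed.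

Lemma foldr_push y u v : reduced v ->
  foldr push v (push y u) = push y (foldr push v u).
Proof.
move=> rv; case: u => //= z u; have [->|//] := eqVneq.
by rewrite pushVK // reduced_foldr.
Qed.

Lemma foldr_reduce u v : reduced v -> foldr push v (reduce u) = foldr push v u.
Proof. by move=> rv; elim: u => //= y u IH; rewrite foldr_push // IH. Qed.

Lemma foldr_winv w v : reduced v -> foldr push (foldr push v w) (winv w) = v.
Proof.
move=> rv; elim: w => //= y w IH.
by rewrite /winv /= rev_cons -cats1 foldr_cat /= pushK ?reduced_foldr.
Qed.

Lemma reduce_cat u v : reduced v -> reduce (u ++ v) = foldr push v u.
Proof. by move=> rv; rewrite /reduce foldr_cat -/(reduce v) reduce_id. Qed.

Lemma reduce_winv w : reduce (winv w ++ w) = [::].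
Proof. by rewrite /reduce foldr_cat foldr_winv. Qed.

End FreeGroup.

Record free_group (g : nat) := FreeGroup {
  fg_word :> seq (letter g);
  _ : reduced fg_word
}.

HB.instance Definition _ g := [isSub for @fg_word g].
HB.instance Definition _ g := [Choice of free_group g by <:].

Section FreeGroupTheory.
Context {g : nat}.
Implicit Types (u v w : free_group g).

Definition fg_reduce (w : seq (letter g)) := FreeGroup (reduce_reduced w).
Definition fg_one := fg_reduce [::].
Definition fg_mul u v := fg_reduce (u ++ v).
Definition fg_inv u := fg_reduce (winv u).

Lemma fg_mulA : associative fg_mul.
Proof.
move=> u v w; apply: val_inj => /=; have rw : reduced w by case: w.
rewrite (reduce_cat _ (reduce_reduced _)) (reduce_cat _ rw).
by rewrite reduce_cat // foldr_reduce // foldr_cat.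
Qed.

Lemma fg_mul1 : left_id fg_one fg_mul.
Proof. by move=> u; apply: val_inj; rewrite /= reduce_id //; case: u. Qed.

Lemma fg_mulg1 : right_id fg_one fg_mul.
Proof. by move=> u; apply: val_inj; rewrite /= cats0 reduce_id //; case: u. Qed.

Lemma fg_mulV : left_inverse fg_one fg_inv fg_mul.
Proof.
move=> u; apply: val_inj => /=; have ru : reduced u by case: u.
by rewrite reduce_cat // foldr_reduce // -reduce_cat // reduce_winv.
Qed.

Lemma fg_mulgV : right_inverse fg_one fg_inv fg_mul.
Proof.
move=> u; apply: val_inj; rewrite /= (reduce_cat _ (reduce_reduced _)).
by have := @foldr_winv _ (winv u) [::] isT; rewrite winvK.
Qed.

End FreeGroupTheory.

HB.instance Definition _ g := isGroup.Build (free_group g)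
  (@fg_mulA g) (@fg_mul1 g) (@fg_mulg1 g) (@fg_mulV g) (@fg_mulgV g).

Definition fg_gen g (s : 'I_g) : free_group g := fg_reduce [:: (s, false)].

(* (a, w) is the symbol a^w. *)
Definition free_rack (g : nat) : Type := ('I_g * free_group g)%type.
HB.instance Definition _ g := Choice.on (free_rack g).

Section FreeRack.
Context {g : nat}.
Implicit Types p q : free_rack g.

Definition fr_op p q : free_rack g :=
  (p.1, (p.2 * q.2^-1 * fg_gen q.1 * q.2)%g).
Definition fr_opV p q : free_rack g :=
  (p.1, (p.2 * q.2^-1 * (fg_gen q.1)^-1 * q.2)%g).

Lemma fr_opK p q : fr_opV (fr_op p q) q = p.
Proof. by case: p => a u; rewrite /fr_opV /fr_op /= !mulgK mulgVK. Qed.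

Lemma fr_opVK p q : fr_op (fr_opV p q) q = p.
Proof. by case: p => a u; rewrite /fr_opV /fr_op /= mulgK !mulgVK. Qed.

Lemma fr_opD p q r : fr_op (fr_op p q) r = fr_op (fr_op p r) (fr_op q r).
Proof.
case: p q r => [a u] [b v] [c w]; rewrite /fr_op /=; congr pair.
by rewrite !invgM !invgK !mulgA; do ![rewrite mulgK|rewrite mulgVK].
Qed.

HB.instance Definition _ := isRack.Build (free_rack g) fr_opK fr_opVK fr_opD.

End FreeRack.

Inductive rack_cong (T : rackType) (P : T -> T -> Prop) : T -> T -> Prop :=
| rc_base x y : P x y -> rack_cong P x y
| rc_refl x : rack_cong P x x
| rc_sym x y : rack_cong P x y -> rack_cong P y x
| rc_trans x y z : rack_cong P x y -> rack_cong P y z -> rack_cong P x z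
| rc_op x x' y y' :
    rack_cong P x x' -> rack_cong P y y' -> rack_cong P (x |> y) (x' |> y')
| rc_opV x x' y y' :
    rack_cong P x x' -> rack_cong P y y' ->
    rack_cong P (x |>^-1 y) (x' |>^-1 y').

(* (i, u, j) is the primary relation x_i^u = x_j. *)
Notation primary g := ('I_g * free_group g * 'I_g)%type.

Definition secondary g (r : primary g) : free_group g :=
  let: (i, u, j) := r in (u^-1 * fg_gen i * u * (fg_gen j)^-1)%g.

Section FinitelyPresentedRack.
Context {g : nat}.
Variable R : seq (primary g).

Definition related (p q : free_rack g) : Prop :=
  exists2 r, r \in R & let: (i, u, j) := r in p = (i, u) /\ q = (j, 1%g).

Definition fp_rel (p q : free_rack g) : bool := `[< rack_cong related p q >].

Lemma fp_rel_refl : reflexive fp_rel.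
Proof. by move=> p; apply/asboolP; apply: rc_refl. Qed.

Lemma fp_rel_sym : symmetric fp_rel.
Proof. by move=> p q; apply/asboolP/asboolP; apply: rc_sym. Qed.

Lemma fp_rel_trans : transitive fp_rel.
Proof. by move=> q p r /asboolP pq /asboolP qr; apply/asboolP/(rc_trans pq). Qed.

Canonical fp_equiv := EquivRel fp_rel fp_rel_refl fp_rel_sym fp_rel_trans.

Local Open Scope quotient_scope.

Definition fp_rack : Type := {eq_quot fp_equiv}.
HB.instance Definition _ := Choice.on fp_rack.
HB.instance Definition _ := EqQuotient.on fp_rack.

Definition fp_op (a b : fp_rack) : fp_rack := \pi_fp_rack (repr a |> repr b).
Definition fp_opV (a b : fp_rack) : fp_rack := \pi_fp_rack (repr a |>^-1 repr b).

Lemma fp_reprP (p : free_rack g) :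
  rack_cong related (repr (\pi_fp_rack p)) p.
Proof.
by apply/asboolP; rewrite -[`[< _ >]]/(fp_equiv _ _) -(eqquotE fp_rack) reprK.
Qed.

Lemma fp_piP (p q : free_rack g) :
  rack_cong related p q -> \pi_fp_rack p = \pi_fp_rack q.
Proof. by move=> pq; apply/eqquotP/asboolP. Qed.

Lemma fp_op_pi p q : fp_op (\pi_fp_rack p) (\pi_fp_rack q) = \pi_fp_rack (p |> q).
Proof. by apply: fp_piP; apply: rc_op; apply: fp_reprP. Qed.

Lemma fp_opV_pi p q : fp_opV (\pi_fp_rack p) (\pi_fp_rack q) = \pi_fp_rack (p |>^-1 q).
Proof. by apply: fp_piP; apply: rc_opV; apply: fp_reprP. Qed.

Lemma fp_opK a b : fp_opV (fp_op a b) b = a.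
Proof.
by elim/quotW: a => p; elim/quotW: b => q; rewrite fp_op_pi fp_opV_pi ropK.
Qed.

Lemma fp_opVK a b : fp_op (fp_opV a b) b = a.
Proof.
by elim/quotW: a => p; elim/quotW: b => q; rewrite fp_opV_pi fp_op_pi ropVK.
Qed.

Lemma fp_opD a b c : fp_op (fp_op a b) c = fp_op (fp_op a c) (fp_op b c).
Proof.
elim/quotW: a => p; elim/quotW: b => q; elim/quotW: c => r.
rewrite (fp_op_pi p q) (fp_op_pi p r) (fp_op_pi q r).
by rewrite (fp_op_pi (p |> q)) (fp_op_pi (p |> r)) ropD.
Qed.

HB.instance Definition _ := isRack.Build fp_rack fp_opK fp_opVK fp_opD.

Definition fp_gen (s : 'I_g) : fp_rack := \pi_fp_rack (s, 1%g).

Definition fp_act (a : fp_rack) (y : letter g) : fp_rack :=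
  if y.2 then a |>^-1 fp_gen y.1 else a |> fp_gen y.1.

End FinitelyPresentedRack.

(* The rows are 1, ..., nrows. On other arguments entry and tau are None and  *)
(* rho is the identity.                                                       *)
Record table (g : nat) (R : seq (primary g)) := Table {
  nrows : nat;
  entry : nat -> letter g -> option nat;
  tau : nat -> option (fp_rack R);
  rho : nat -> nat
}.

(* The loops that are not bounded in advance take a fuel argument and return  *)
(* None exactly when the fuel runs out, so that a procedure terminates if and *)
(* only if it returns Some result for some amount of fuel.                    *)
Section Procedures.
Context {g : nat} {R : seq (primary g)}.
Implicit Types (E : table R) (i j k l m n d e : nat) (y : letter g).
Implicit Types (w : seq (letter g)) (Q : seq nat).

Definition set_entry E i y (v : option nat) : table R :=
  Table (nrows E) (fun j z => if (j == i) && (z == y) then v else entry E j z)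
    (tau E) (rho E).

Definition set_rho E (r : nat -> nat) : table R :=
  Table (nrows E) (entry E) (tau E) r.

(* {rho^t(i) : t >= 0}: as rho(j) <= j, at most i iterations reach a fixed    *)
(* point.                                                                     *)
Definition rho_orbit E i : seq nat := traject (rho E) i i.+1.

Definition REP E i : nat := \big[minn/i]_(j <- rho_orbit E i) j.

Definition live E : seq nat := [seq i <- iota 1 (nrows E) | rho E i == i].

Definition max_live E : nat := \max_(i <- live E) i.

(* The row of x_(s+1). *)
Definition gen_row (s : 'I_g) : nat := s.+1.

Definition INIT : table R :=
  Table g (fun _ _ => None)
    (fun i => if i is i'.+1 then omap (fp_gen R) (insub i') else None)
    (fun i => i).

Definition DEFINE E i y : table R :=
  let k := (nrows E).+1 in
  let E' := set_entry (set_entry E i y (Some k)) k (linv y) (Some i) in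
  Table k (entry E') [eta tau E with k |-> omap (fun a => fp_act a y) (tau E i)]
    [eta rho E with k |-> k].

Definition DEDUCTION E i y j : table R :=
  set_entry (set_entry E i y (Some j)) j (linv y) (Some i).

Definition UPDATE E i : table R :=
  let r := REP E i in
  set_rho E (fun j => if j \in rho_orbit E i then r else rho E j).

Definition MERGE (EQ : table R * seq nat) m n : table R * seq nat :=
  let: (E, Q) := EQ in
  let mu := REP E m in
  let nu := REP E n in
  if mu == nu then (E, Q)
  else (set_rho E [eta rho E with maxn mu nu |-> minn mu nu],
        rcons Q (maxn mu nu)).

Definition coincidence_step d (EQ : table R * seq nat) y :
    table R * seq nat :=
  let: (E, Q) := EQ in
  if entry E d y is Some e then
    let E1 := set_entry (set_entry E d y None) e (linv y) None in
    let delta := REP E1 d in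
    let E2 := UPDATE E1 d in
    let epsilon := REP E2 e in
    let E3 := UPDATE E2 e in
    match entry E3 delta y, entry E3 epsilon (linv y) with
    | Some f, _ => MERGE (E3, Q) epsilon f
    | None, Some f => MERGE (E3, Q) delta f
    | None, None => (DEDUCTION E3 delta y epsilon, Q)
    end
  else (E, Q).

Section CoincidenceOrder.
(* The order in which COINCIDENCE runs through the letters. *)
Variable LC : seq (letter g).

Fixpoint process_queue (fuel : nat) (EQ : table R * seq nat) :
    option (table R) :=
  let: (E, Q) := EQ in
  if Q is d :: Q' then
    if fuel is fuel'.+1
    then process_queue fuel' (foldl (coincidence_step d) (E, Q') LC)
    else None
  else Some E.

Definition COINCIDENCE fuel E m n : option (table R) :=
  process_queue fuel (MERGE (E, [::]) m n).

(* Follows w from row k as far as possible; returns the row reached and the   *)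
(* part of w not yet read.                                                    *)
Fixpoint trace E k w : nat * seq (letter g) :=
  if w is y :: w' then
    if entry E k y is Some k' then trace E k' w' else (k, w)
  else (k, w).

(* The word passed around is the unread middle part y_f ... y_b of the word   *)
(* being scanned: f < b, f = b and f > b mean that its size is at least 2, is *)
(* 1 and is 0. Reading it backwards from l is reading its inverse from l.     *)
Fixpoint SCAN (fuel : nat) E k w l : option (table R) :=
  if fuel is fuel'.+1 then
    let: (k', w1) := trace E k w in
    let: (l', w2) := trace E l (winv w1) in
    match winv w2 with
    | [::] => if k' == l' then Some E else COINCIDENCE fuel' E k' l'
    | [:: y] => Some (DEDUCTION E k' y l')
    | y :: w3 => SCAN fuel' (DEFINE E k' y) k' (y :: w3) l'
    end
  else None.

Fixpoint scan_primary fuel E (rs : seq (primary g)) : option (table R) :=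
  if rs is (i, u, j) :: rs' then
    obind (fun E' => scan_primary fuel E' rs')
      (SCAN fuel E (REP E (gen_row i)) u (REP E (gen_row j)))
  else Some E.

Fixpoint scan_secondary fuel E i (ws : seq (free_group g)) :
    option (table R) :=
  if ws is w :: ws' then
    if i \in live E
    then obind (fun E' => scan_secondary fuel E' i ws') (SCAN fuel E i w i)
    else Some E
  else Some E.

Variables (R2 : seq (free_group g)) (LE : seq (letter g)).

Definition fill_row E i : table R :=
  if i \in live E then
    foldl (fun E y => if entry E i y is None then DEFINE E i y else E) E LE
  else E.

Variant outcome := Completed of table R | RunLimitExceeded.

Fixpoint main_loop (fuel M : nat) E i : option outcome :=
  if (i <= max_live E) && (i <= M) then
    if fuel is fuel'.+1 then
      obind (fun E' => main_loop fuel' M (fill_row E' i) i.+1)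
        (scan_secondary fuel' E i R2)
    else None
  else Some (if max_live E < i then Completed E else RunLimitExceeded).

Definition ENUMERATE (fuel M : nat) : option outcome :=
  obind (fun E => main_loop fuel M E 1) (scan_primary fuel INIT R).

Definition completes (M : nat) : Prop :=
  exists fuel E, ENUMERATE fuel M = Some (Completed E).

End CoincidenceOrder.

End Procedures.

Arguments completes {g} R LC R2 LE M.

(* Main.v *)
Require Import Defs.
From mathcomp Require Import all_boot zify.
From mathcomp Require Import boolp classical_sets cardinality.

Set Implicit Arguments.
Unset Strict Implicit.
Unset Printing Implicit Defensive.

(** Every step of the enumeration is sound: a scan identifies two rows, or adds
    an entry, only if the rack forces it, so [tau] intertwines the entries of
    the table with the action of the generators ([coherent]). If the process
    stops, every live row has all its entries. The elements [tau i], for [i]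
    live, then contain the generators and are stable under the action of the
    letters, so they exhaust the rack, which is finite ([filled_finite]).

    Conversely, let the main loop run for ever. A coincidence erases entries,
    but it transfers each of them to the representatives of its ends. So the
    equivalence [REP i = REP j], and the relation saying that some row
    equivalent to [i] has a [y]-entry equivalent to [j], never lose anything
    ([extends]). Representatives decrease, hence stabilise, and the stable rows
    form a set on which every letter acts: everywhere, since the [n]-th turn
    fills row [n]; in only one way, since between turns all entries join live
    rows; and bijectively, since the table is symmetric. In this limit the
    primary relations hold at the generators and the secondary relations hold
    everywhere, because they have been scanned, and this is exactly what is
    needed to map the presented rack to the limit ([fp_rack_eval]). If the rack
    is finite, so is its image. That image contains all the stable rows, since
    every row is reached from the rows of the generators. Once the entries
    leaving these finitely many rows are stable too, a live row reached from
    the generators can only be one of them. The live rows are then bounded, the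
    counter of the main loop overtakes them, and the process completes
    ([finite_run_stops]).

    That each procedure terminates needs a measure. In a coincidence a row
    enters the queue only when it dies, so the number of live rows plus the
    length of the queue drops with each processed row; in a scan the unread
    word gets shorter. A result obtained with some fuel is also obtained with
    any larger amount, so the fuels of successive procedures can be replaced by
    their maximum. *)

(** * Words acting on a set *)

Section WordAction.
Context {g : nat} {T : Type}.
Variable act : T -> letter g -> T.
Hypothesis actK : forall k y, act (act k y) (linv y) = k.

Definition fg_act k (u : free_group g) : T := foldl act k u.

Lemma foldl_push k y w : foldl act k (push y w) = foldl act (act k y) w.
Proof. by case: w => //= z w; case: eqP => [->|]; rewrite ?actK. Qed.

Lemma foldl_reduce k w : foldl act k (reduce w) = foldl act k w.
Proof. by elim: w k => //= y w IH k; rewrite foldl_push IH. Qed.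

Lemma fg_act_reduce k w : fg_act k (fg_reduce w) = foldl act k w.
Proof. exact: foldl_reduce. Qed.

Lemma fg_actM k u v : fg_act k (u * v)%g = fg_act (fg_act k u) v.
Proof. by rewrite /fg_act [LHS]foldl_reduce foldl_cat. Qed.

Lemma fg_actK k u : fg_act (fg_act k u) (u^-1)%g = k.
Proof. by rewrite -fg_actM mulgV. Qed.

Lemma fg_actVK k u : fg_act (fg_act k (u^-1)%g) u = k.
Proof. by rewrite -fg_actM mulVg. Qed.

Lemma eq_fg_actV u v : fg_act^~ u =1 fg_act^~ v ->
  fg_act^~ (u^-1)%g =1 fg_act^~ (v^-1)%g.
Proof. by move=> uv k; rewrite -{1}[k](fg_actVK k v) -uv fg_actK. Qed.

Lemma foldl_winv k w : foldl act (foldl act k w) (winv w) = k.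
Proof.
elim: w k => [|y w IH] k //=.
by rewrite /winv /= rev_cons -cats1 foldl_cat IH /= actK.
Qed.

End WordAction.

(** * The universal property of a presented rack *)

(** The element of the free group by which a symbol acts on the right: both
    operations of the free rack are right translations by it or its inverse. *)
Definition fr_conj g (p : free_rack g) : free_group g :=
  (p.2^-1 * fg_gen p.1 * p.2)%g.

Section FreeRackConj.
Context {g : nat}.
Implicit Types p q : free_rack g.

Lemma fr_opE p q : p |> q = (p.1, p.2 * fr_conj q)%g.
Proof. by rewrite [LHS]/= /fr_op /fr_conj !mulgA. Qed.

Lemma fr_opVE p q : p |>^-1 q = (p.1, p.2 * (fr_conj q)^-1)%g.
Proof. by rewrite [LHS]/= /fr_opV /fr_conj !invgM invgK !mulgA. Qed.

Lemma fr_conj_mul p u :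
  fr_conj (p.1, p.2 * u)%g = (u^-1 * fr_conj p * u)%g.
Proof. by rewrite /fr_conj /= invgM !mulgA. Qed.

End FreeRackConj.

Section UniversalProperty.
Context {g : nat} {R : seq (primary g)} {T : Type}.
Variables (act : T -> letter g -> T) (base : 'I_g -> T).
Hypothesis actK : forall k y, act (act k y) (linv y) = k.
Hypothesis act_primary : forall i u j, (i, u, j) \in R ->
  fg_act act (base i) u = base j.
Hypothesis act_secondary : forall r k, r \in R ->
  fg_act act k (secondary r) = k.

Let eval (p : free_rack g) : T := fg_act act (base p.1) p.2.

(** Evaluation alone is not visibly a congruence: the value of [p |> q] depends
    on how [q] acts, not only on its value. Adding the action of [fr_conj] to
    the relation makes it one. The relation then contains a primary relation
    because the matching secondary one acts trivially. *)
Lemma rack_cong_eval p q : rack_cong (related R) p q ->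
  eval p = eval q /\ fg_act act^~ (fr_conj p) =1 fg_act act^~ (fr_conj q).
Proof.
have opE x y : eval (x |> y) = fg_act act (eval x) (fr_conj y).
  by rewrite fr_opE /eval /= (fg_actM actK).
have opVE x y : eval (x |>^-1 y) = fg_act act (eval x) (fr_conj y)^-1%g.
  by rewrite fr_opVE /eval /= (fg_actM actK).
have conjE x u k : fg_act act k (fr_conj (x.1, x.2 * u)%g) =
    fg_act act (fg_act act (fg_act act k u^-1%g) (fr_conj x)) u.
  by rewrite fr_conj_mul !(fg_actM actK).
elim=> {p q} [p q [[[i u] j] rR [-> ->]]|p|p q _ [e c]|p q r _ [e1 c1] _ [e2 c2]
  |p p' q q' _ [e c] _ [e' c']|p p' q q' _ [e c] _ [e' c']] //.
- split=> [|k]; first exact: act_primary rR.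
  have := act_secondary k rR; rewrite /secondary (fg_actM actK) => e.
  by rewrite -{2}e /fr_conj /= invg1 mul1g mulg1 (fg_actVK actK).
- by split=> [|k]; [rewrite e|exact: esym].
- by split=> [|k]; [rewrite e1|rewrite c1].
- have c'V := eq_fg_actV actK c'.
  split=> [|k]; first by rewrite !opE e c'.
  by rewrite !fr_opE !conjE c' c c'V.
- have c'V := eq_fg_actV actK c'.
  split=> [|k]; first by rewrite !opVE e c'V.
  by rewrite !fr_opVE !conjE !invgK c'V c c'.
Qed.

End UniversalProperty.

Section PresentedRack.
Context {g : nat} {R : seq (primary g)}.
Local Open Scope quotient_scope.

Local Notation pi := (\pi_(fp_rack R)).

Lemma fg_reduce_cat (u v : seq (letter g)) :
  fg_reduce (u ++ v) = (fg_reduce u * fg_reduce v)%g.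
Proof.
apply: val_inj; rewrite [RHS](reduce_cat _ (reduce_reduced _)).
by rewrite [RHS]foldr_reduce ?reduce_reduced //= /reduce foldr_cat.
Qed.

Lemma fp_act_pi a (u : free_group g) y :
  fp_act (pi (a, u)) y = pi (a, u * fg_reduce [:: y])%g.
Proof.
have genV : ((fg_gen y.1)^-1 = fg_reduce [:: (y.1, true)])%g by apply: val_inj.
have conj1 : fr_conj (y.1, 1%g) = fg_gen y.1.
  by rewrite /fr_conj /= invg1 mul1g mulg1.
rewrite /fp_act; case: y genV conj1 => s [] /= genV conj1.
- by rewrite [LHS]fp_opV_pi fr_opVE conj1 genV.
- by rewrite [LHS]fp_op_pi fr_opE conj1.
Qed.

Lemma foldl_fp_act_pi a (u : free_group g) w :
  foldl (@fp_act g R) (pi (a, u)) w = pi (a, u * fg_reduce w)%g.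
Proof.
elim: w u => [|y w IH] u /=; first by congr (pi (a, _)); rewrite -[LHS]mulg1.
by rewrite fp_act_pi IH -[y :: w]cat1s fg_reduce_cat mulgA.
Qed.

Lemma fg_wordK (u : free_group g) : fg_reduce u = u.
Proof. by apply: val_inj; apply: reduce_id; case: u. Qed.

Lemma fp_rack_gen (x : fp_rack R) :
  exists s (u : free_group g), x = foldl (@fp_act g R) (fp_gen R s) u.
Proof.
elim/quotW: x => -[s u]; exists s, u.
by rewrite foldl_fp_act_pi mul1g fg_wordK.
Qed.

Lemma fp_actK (x : fp_rack R) y : fp_act (fp_act x y) (linv y) = x.
Proof. by rewrite /fp_act; case: y => s []; rewrite /= ?ropK ?ropVK. Qed.

Lemma fp_primary i (u : free_group g) j : (i, u, j) \in R ->
  foldl (@fp_act g R) (fp_gen R i) u = fp_gen R j.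
Proof.
move=> rR; rewrite foldl_fp_act_pi mul1g fg_wordK.
by apply: fp_piP; apply: rc_base; exists (i, u, j).
Qed.

(** A secondary relation says that [x_i^u] and [x_j], being equal, act in the
    same way. *)
Lemma fp_secondary r (x : fp_rack R) : r \in R ->
  foldl (@fp_act g R) x (secondary r) = x.
Proof.
case: r => [[i u] j] rR; elim/quotW: x => -[a v].
rewrite foldl_fp_act_pi fg_wordK -[RHS](ropK _ (fp_gen R j)).
have /esym := fp_primary rR; rewrite foldl_fp_act_pi mul1g fg_wordK => e.
rewrite {1}e; transitivity ((pi (a, v) |> pi (i, u)) |>^-1 pi (j, 1%g)); last by [].
rewrite [X in X |>^-1 _]fp_op_pi [RHS]fp_opV_pi; congr (pi _).
by rewrite fr_opE fr_opVE /fr_conj /= invg1 mul1g mulg1 !mulgA.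
Qed.

(** The rack is the free object among the sets on which the letters act, with a
    base point for each generator, such that the primary relations hold at the
    base points and the secondary ones everywhere. A completed table describes
    a set of this kind. *)
Lemma fp_rack_eval (T : Type) (act : T -> letter g -> T) (base : 'I_g -> T) :
  (forall k y, act (act k y) (linv y) = k) ->
  (forall i u j, (i, u, j) \in R -> fg_act act (base i) u = base j) ->
  (forall r k, r \in R -> fg_act act k (secondary r) = k) ->
  exists f : fp_rack R -> T,
    forall s w, f (foldl (@fp_act g R) (fp_gen R s) w) = foldl act (base s) w.
Proof.
move=> actK act_primary act_secondary.
exists (fun x => fg_act act (base (repr x).1) (repr x).2) => s w.
rewrite foldl_fp_act_pi mul1g -(fg_act_reduce actK).
by have [-> _] := rack_cong_eval actK act_primary act_secondary
  (fp_reprP R (s, fg_reduce w)).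
Qed.

End PresentedRack.

(** * Representatives *)

Lemma bigminn_eq m x (s : seq nat) :
  m \in s -> m <= x -> {in s, forall j, m <= j} -> \big[minn/x]_(j <- s) j = m.
Proof.
move=> ms mx ge; apply/eqP; rewrite eqn_leq; apply/andP; split.
- elim: s ms {ge} => // j s IH; rewrite inE big_cons geq_min.
  by case/orP=> [/eqP->|/IH->]; rewrite ?leqnn ?orbT.
- elim: s ge {ms} => [|j s IH] ge; rewrite ?big_nil // big_cons leq_min.
  by rewrite ge ?mem_head //= IH // => k ks; rewrite ge // inE ks orbT.
Qed.

Section Representative.
Context {g : nat} {R : seq (primary g)}.
Variable E : table R.
Hypothesis rho_le : forall i, rho E i <= i.

Lemma iter_rho_le t i : iter t (rho E) i <= i.
Proof. by elim: t => //= t IH; apply: leq_trans IH. Qed.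

Lemma iter_rho_fixed n i : i <= n ->
  rho E (iter n (rho E) i) = iter n (rho E) i.
Proof.
elim: n i => [|n IH] i le_in; first by have /= := rho_le i; lia.
have [ri|ri] := eqVneq (rho E i) i; first by rewrite iter_fix.
by rewrite iterSr IH //; have := rho_le i; lia.
Qed.

Lemma REP_iter n i : i <= n -> REP E i = iter n (rho E) i.
Proof.
move=> le_in; have iter_decr t m : t <= m -> iter m (rho E) i <= iter t (rho E) i.
  by move=> tm; rewrite -(subnK tm) iterD iter_rho_le.
transitivity (iter i (rho E) i).
  apply: bigminn_eq => [||_ /trajectP[t ti ->]]; last exact: iter_decr.
  - by apply/trajectP; exists i.
  - exact: iter_rho_le.
by rewrite -(subnK le_in) iterD [RHS]iter_fix // iter_rho_fixed.
Qed.

Lemma rho_REP i : rho E (REP E i) = REP E i.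
Proof. by rewrite (REP_iter (leqnn i)) iter_rho_fixed. Qed.

Lemma REP_le i : REP E i <= i.
Proof. by rewrite (REP_iter (leqnn i)) iter_rho_le. Qed.

Lemma REP_rho i : REP E (rho E i) = REP E i.
Proof.
by rewrite (REP_iter (rho_le i)) -iterSr -(REP_iter (leqnSn i)).
Qed.

Lemma REP_fixed i : rho E i = i -> REP E i = i.
Proof. by move=> ri; rewrite (REP_iter (leqnn i)) iter_fix. Qed.

Lemma REP_idem i : REP E (REP E i) = REP E i.
Proof. exact/REP_fixed/rho_REP. Qed.

Lemma rho_fixedE i : (rho E i == i) = (REP E i == i).
Proof.
by apply/eqP/eqP => [|ri]; [apply: REP_fixed | rewrite -[in LHS]ri rho_REP].
Qed.

(** The tool for computing representatives after [rho] has changed: guess the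
    new function, then check it one application of [rho] at a time. *)
Lemma REP_unique f : (forall i, f (rho E i) = f i) ->
  (forall i, rho E i = i -> f i = i) -> f =1 REP E.
Proof.
move=> f_rho f_fixed i; rewrite -[RHS]f_fixed ?rho_REP // (REP_iter (leqnn i)).
by elim: {2}i => //= t ->; rewrite f_rho.
Qed.

Lemma REP_orbit i j : j \in rho_orbit E i -> REP E j = REP E i.
Proof. by case/trajectP=> t _ ->; elim: t => //= t IH; rewrite REP_rho. Qed.

End Representative.

(** * Coherent tables *)

Section Invariant.
Context {g : nat} {R : seq (primary g)}.
Implicit Types (E : table R) (i j k l m n d e : nat) (y z : letter g).
Implicit Types (P Q : seq nat).

Definition row E i : bool := 0 < i <= nrows E.

(** The invariant of the procedures. [P] lists the dead rows whose entries have
    not been transferred yet; it is the queue during a coincidence, together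
    with the row being processed, and is empty between procedures. The fields
    on [tau] are the soundness of the table. *)
Record coherent E P : Prop := Coherent {
  coh_rho_le : forall i, rho E i <= i;
  coh_rho_gt0 : forall i, 0 < i -> 0 < rho E i;
  coh_rho_out : forall i, nrows E < i -> rho E i = i;
  coh_row : forall i y j, entry E i y = Some j -> row E i;
  coh_sym : forall i y j, entry E i y = Some j -> entry E j (linv y) = Some i;
  coh_live : forall i y j, entry E i y = Some j -> (rho E i == i) || (i \in P);
  coh_dead : forall d, d \in P -> rho E d != d;
  coh_tau_row : forall i, row E i -> tau E i <> None;
  coh_tau_rho : forall i, tau E (rho E i) = tau E i;
  coh_tau_entry : forall i y j, entry E i y = Some j ->
    tau E j = omap (fun a => fp_act a y) (tau E i);
  coh_tau_gen : forall s : 'I_g, tau E (gen_row s) = Some (fp_gen R s);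
  coh_gens : g <= nrows E
}.

Lemma coh_row_target E P i y j : coherent E P -> entry E i y = Some j -> row E j.
Proof. by move=> I /(coh_sym I)/(coh_row I). Qed.

Lemma REP_gt0 E P i : coherent E P -> 0 < i -> 0 < REP E i.
Proof.
move=> I i_gt0; rewrite (REP_iter (coh_rho_le I) (leqnn i)).
by elim: {1}i => //= t; apply: coh_rho_gt0 I _.
Qed.

Lemma row_REP E P i : coherent E P -> row E i -> row E (REP E i).
Proof.
move=> I /andP[i_gt0 iE]; rewrite /row (REP_gt0 I) //=.
exact: leq_trans (REP_le (coh_rho_le I) i) iE.
Qed.

Lemma tau_REP E P i : coherent E P -> tau E (REP E i) = tau E i.
Proof.
move=> I; rewrite (REP_iter (coh_rho_le I) (leqnn i)).
by elim: {1}i => //= t; rewrite (coh_tau_rho I).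
Qed.

Lemma gen_row_row E P (s : 'I_g) : coherent E P -> row E (gen_row s).
Proof. by move=> I; apply: leq_trans (ltn_ord s) (coh_gens I). Qed.

Lemma mem_live E P i : coherent E P -> (i \in live E) = row E i && (rho E i == i).
Proof. by move=> I; rewrite mem_filter mem_iota /row; lia. Qed.

Lemma linv_neq y : linv y != y.
Proof. by case: y => s []; rewrite xpair_eqE andbF. Qed.

(** * What a table knows up to representatives *)

(** Entries are compared modulo [REP] because single entries do not survive
    a coincidence, while the relation that they induce on classes does. *)
Definition class_entry E i y j : Prop := exists i' j',
  [/\ REP E i' = REP E i, REP E j' = REP E j & entry E i' y = Some j'].

Fixpoint class_path E i w j : Prop :=
  if w is y :: w' then exists2 k, class_entry E i y k & class_path E k w' j
  else REP E i = REP E j.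

Inductive reached E : nat -> Prop :=
| reached_gen (s : 'I_g) j : REP E (gen_row s) = REP E j -> reached E j
| reached_entry i y j : reached E i -> class_entry E i y j -> reached E j.

(** The order in which tables grow: identifications and entries between classes
    persist. *)
Record extends E E' : Prop := Extends {
  extends_nrows : nrows E <= nrows E';
  extends_REP : forall i, REP E' (REP E i) = REP E' i;
  extends_entry : forall i y j, entry E i y = Some j -> class_entry E' i y j
}.

Lemma extends_eqREP E E' i j :
  extends E E' -> REP E i = REP E j -> REP E' i = REP E' j.
Proof. by move=> X ij; rewrite -(extends_REP X i) ij (extends_REP X). Qed.

Lemma extends_class_entry E E' i y j :
  extends E E' -> class_entry E i y j -> class_entry E' i y j.
Proof.
move=> X [i' [j' [ii' jj' /(extends_entry X)[i2 [j2 [ii2 jj2 e]]]]]].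
exists i2, j2; split=> //; first by rewrite ii2 (extends_eqREP X ii').
by rewrite jj2 (extends_eqREP X jj').
Qed.

Lemma extends_class_path E E' i w j :
  extends E E' -> class_path E i w j -> class_path E' i w j.
Proof.
move=> X; elim: w i => [|y w IH] i /=; first exact: extends_eqREP.
by case=> k /(extends_class_entry X) ik /IH kj; exists k.
Qed.

Lemma extends_reached E E' i : extends E E' -> reached E i -> reached E' i.
Proof.
move=> X; elim=> [s j /(extends_eqREP X)|k y j _ IH /(extends_class_entry X)].
  exact: reached_gen.
exact: reached_entry.
Qed.

Lemma extends_trans E2 E1 E3 : extends E1 E2 -> extends E2 E3 -> extends E1 E3.
Proof.
move=> X Y; split; first exact: leq_trans (extends_nrows X) (extends_nrows Y).
- by move=> i; apply: (extends_eqREP Y); apply: (extends_REP X).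
- by move=> i y j /(extends_entry X)/(extends_class_entry Y).
Qed.

Lemma entry_class_entry E i y j : entry E i y = Some j -> class_entry E i y j.
Proof. by exists i, j. Qed.

Lemma extends_refl E P : coherent E P -> extends E E.
Proof.
move=> I; split=> // [i|i y j]; first exact: REP_idem (coh_rho_le I) i.
exact: entry_class_entry.
Qed.

Lemma extends_REP_le E E' P i :
  coherent E' P -> extends E E' -> REP E' i <= REP E i.
Proof. by move=> I X; rewrite -(extends_REP X) REP_le //; apply: coh_rho_le I. Qed.

Lemma class_path_cat E i u k v j :
  class_path E i u k -> class_path E k v j -> class_path E i (u ++ v) j.
Proof.
elim: u i => [|y u IH] i /= => [ik|[l il lk] kj]; last by exists l => //; apply: IH lk kj.
case: v => [|y v] /=; first by rewrite ik.
by case=> l [i' [l' [ii' ll' e]]] lj; exists l => //; exists i', l'; rewrite ik.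
Qed.

Lemma class_path_eq E i w j i' j' : REP E i = REP E i' -> REP E j = REP E j' ->
  class_path E i w j -> class_path E i' w j'.
Proof.
move=> ii' jj' p; apply: (@class_path_cat E i' [::] i w j' (esym ii')).
by rewrite -[w]cats0; apply: (@class_path_cat E i w j [::] j').
Qed.

Lemma class_entry_sym E P i y j :
  coherent E P -> class_entry E i y j -> class_entry E j (linv y) i.
Proof. by move=> I [i' [j' [ii' jj' /(coh_sym I)]]]; exists j', i'. Qed.

Lemma class_path_winv E P i w j : coherent E P ->
  class_path E i w j -> class_path E j (winv w) i.
Proof.
move=> I; elim: w i => [|y w IH] i /=; first exact: esym.
case=> k ik /IH kj; rewrite /winv /= rev_cons -cats1.
by apply: class_path_cat kj _; exists i => //; apply: class_entry_sym I ik.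
Qed.

Lemma class_entry_tau E P i y j : coherent E P -> class_entry E i y j ->
  tau E j = omap (fun a => fp_act a y) (tau E i).
Proof.
move=> I [i' [j' [ii' jj' /(coh_tau_entry I)]]].
by rewrite -(tau_REP j' I) jj' -(tau_REP i' I) ii' !(tau_REP _ I).
Qed.

Lemma class_path_tau E P i w j : coherent E P -> class_path E i w j ->
  tau E j = omap (fun a => foldl (@fp_act g R) a w) (tau E i).
Proof.
move=> I; elim: w i => [|y w IH] i /=.
  by move=> ij; rewrite -(tau_REP j I) -ij (tau_REP i I); case: (tau E i).
by case=> k /(class_entry_tau I) ik /IH ->; rewrite ik; case: (tau E i).
Qed.

(** Without pending rows all entries join live rows, so a class has at most
    one entry for each letter, stored at its representative. *)
Lemma class_entry_live E i y j : coherent E [::] ->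
  class_entry E i y j <-> entry E (REP E i) y = Some (REP E j).
Proof.
move=> I; have live_REP k z l : entry E k z = Some l -> REP E k = k.
  by move/(coh_live I); rewrite orbF => /eqP/(REP_fixed (coh_rho_le I)).
split=> [[i' [j' [ii' jj' e]]]|e].
  by rewrite -ii' -jj' (live_REP _ _ _ e) (live_REP _ _ _ (coh_sym I e)).
by exists (REP E i), (REP E j); rewrite !(REP_idem (coh_rho_le I)).
Qed.

End Invariant.

(** * The elementary operations *)

Section Operations.
Context {g : nat} {R : seq (primary g)}.
Implicit Types (E : table R) (i j k l m n d e : nat) (y z : letter g).
Implicit Types (P Q : seq nat).

Lemma entry_deductionE E k y l i z : entry (DEDUCTION E k y l) i z =
  if (i == l) && (z == linv y) then Some k
  else if (i == k) && (z == y) then Some l else entry E i z.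
Proof. by []. Qed.

Lemma entry_deduction E k y l : entry (DEDUCTION E k y l) k y = Some l.
Proof.
by rewrite entry_deductionE !eqxx [y == _]eq_sym (negPf (linv_neq y)) andbF.
Qed.

(** Both entries must be free: overwriting one would break the symmetry of the
    table at its former target. *)
Lemma coherent_deduction E P k y l : coherent E P -> row E k -> row E l ->
  rho E k = k -> rho E l = l ->
  tau E l = omap (fun a => fp_act a y) (tau E k) ->
  entry E k y = None -> entry E l (linv y) = None ->
  coherent (DEDUCTION E k y l) P.
Proof.
move=> I kE lE rk rl tkl k0 l0; split; try by case: I.
- move=> i z j; rewrite entry_deductionE.
  case: andP => [[/eqP-> _ _]|_] //; case: andP => [[/eqP-> _ _]|_] //.
  by move/(coh_row I).
- move=> i z j; rewrite !entry_deductionE.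
  case: andP => [[/eqP-> /eqP-> [<-]]|il].
    by rewrite linvK !eqxx [y == _]eq_sym (negPf (linv_neq y)) andbF.
  case: andP => [[/eqP-> /eqP-> [<-]]|ik]; first by rewrite !eqxx.
  move=> e; have e' := coh_sym I e.
  case: andP => [[/eqP jl /eqP zy]|_]; first by rewrite jl zy l0 in e'.
  by case: andP => [[/eqP jk /eqP zy]|//]; rewrite jk zy k0 in e'.
- move=> i z j; rewrite entry_deductionE.
  case: andP => [[/eqP-> _ _]|_]; first by rewrite rl eqxx.
  case: andP => [[/eqP-> _ _]|_]; first by rewrite rk eqxx.
  by move/(coh_live I).
- move=> i z j; rewrite entry_deductionE.
  case: andP => [[/eqP-> /eqP-> [<-]]|_].
    by rewrite tkl /=; case: (tau E k) => //= a; rewrite fp_actK.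
  case: andP => [[/eqP-> /eqP-> [<-]]|_] //.
  by move/(coh_tau_entry I).
Qed.

Lemma extends_deduction E k y l P : coherent E P ->
  entry E k y = None -> entry E l (linv y) = None ->
  extends E (DEDUCTION E k y l).
Proof.
move=> I k0 l0; split=> // [i|i z j e]; first exact: REP_idem (coh_rho_le I) i.
apply: entry_class_entry; rewrite entry_deductionE.
case: andP => [[/eqP il /eqP zy]|_]; first by rewrite il zy l0 in e.
by case: andP => [[/eqP ik /eqP zy]|//]; rewrite ik zy k0 in e.
Qed.

(** The new row is first created without entries, so that its link to row [i]
    can be treated as a deduction. *)
Definition add_row E i y : table R :=
  let k := (nrows E).+1 in
  Table k (entry E)
    [eta tau E with k |-> omap (fun a => fp_act a y) (tau E i)]
    [eta rho E with k |-> k].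

Lemma DEFINE_deduction E i y :
  DEFINE E i y = DEDUCTION (add_row E i y) i y (nrows E).+1.
Proof. by []. Qed.

Lemma entry_define E i y : entry (DEFINE E i y) i y = Some (nrows E).+1.
Proof. exact: entry_deduction. Qed.

Lemma rho_add_row E P i y : coherent E P -> rho (add_row E i y) =1 rho E.
Proof. by move=> I j /=; case: eqP => [->|//]; rewrite (coh_rho_out I). Qed.

Lemma coherent_add_row E P i y :
  coherent E P -> row E i -> coherent (add_row E i y) P.
Proof.
move=> I iE; have r := rho_add_row i y I.
have rowW j : row E j -> row (add_row E i y) j by rewrite /row /=; lia.
have rowE j : row (add_row E i y) j -> row E j \/ j = (nrows E).+1.
  by rewrite /row /=; lia.
have tauE j : row E j -> tau (add_row E i y) j = tau E j.
  by rewrite /row /=; case: eqP => // ->; lia.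
split.
- by move=> j; rewrite r; apply: coh_rho_le I _.
- by move=> j; rewrite r; apply: coh_rho_gt0 I _.
- by move=> j /= lt; rewrite -[RHS](coh_rho_out I (ltnW lt)); apply: r.
- by move=> j z l /(coh_row I)/rowW.
- by move=> j z l; apply: coh_sym I _ _ _.
- by move=> j z l; rewrite r; apply: coh_live I _ _ _.
- by move=> d; rewrite r; apply: coh_dead I _.
- move=> j /rowE[jE|->]; first by rewrite tauE //; apply: coh_tau_row I _ jE.
  by rewrite /= eqxx; case: (tau E i) (coh_tau_row I iE).
- move=> j; rewrite r /=; case: (j =P (nrows E).+1) => [->|ne].
    by rewrite (coh_rho_out I) // eqxx.
  case: eqP => [e|_]; last exact: coh_tau_rho I j.
  case: (leqP j (nrows E)) => lt; last by rewrite (coh_rho_out I lt) in e.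
  by have := coh_rho_le I j; lia.
- move=> j z l e; rewrite !tauE ?(coh_row I e) ?(coh_row_target I e) //.
  exact: coh_tau_entry I _ _ _ e.
- by move=> s; rewrite tauE ?(coh_tau_gen I) // (gen_row_row s I).
- exact: leqW (coh_gens I).
Qed.

Lemma eq_REP E E' P : coherent E P -> rho E' =1 rho E -> REP E' =1 REP E.
Proof.
move=> I r i; apply/esym/REP_unique => [j|j|j]; rewrite r.
- exact: coh_rho_le I j.
- exact: REP_rho (coh_rho_le I) j.
- by move/(REP_fixed (coh_rho_le I)).
Qed.

Lemma coherent_define E P i y : coherent E P -> row E i -> rho E i = i ->
  entry E i y = None -> coherent (DEFINE E i y) P.
Proof.
move=> I iE ri e; have r := rho_add_row i y I.
have IA := coherent_add_row y I iE; have iN : i != (nrows E).+1 by move: iE; rewrite /row; lia.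
rewrite DEFINE_deduction; apply: coherent_deduction => //; rewrite ?r //.
- by move: iE; rewrite /row /=; lia.
- by rewrite /row /=.
- exact: coh_rho_out I _ _.
- by rewrite /= eqxx (negPf iN).
- case new: (entry _ _ _) => [j|//]; have /andP[_] := coh_row I new.
  by rewrite ltnn.
Qed.

Lemma extends_define E P i y : coherent E P -> row E i ->
  entry E i y = None -> extends E (DEFINE E i y).
Proof.
move=> I iE e; apply: (@extends_trans _ _ (add_row E i y)).
  have r := eq_REP I (rho_add_row i y I).
  split=> [|j|j z l jl]; first exact: leqnSn.
    by rewrite !r (REP_idem (coh_rho_le I)).
  exact: entry_class_entry.
apply: extends_deduction (coherent_add_row y I iE) _ _ => //.
case new: (entry _ _ _) => [j|//]; have /andP[_] := coh_row I new.
by rewrite ltnn.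
Qed.

Definition erase E d y e := set_entry (set_entry E d y None) e (linv y) None.

Lemma entry_eraseE E d y e i z : entry (erase E d y e) i z =
  if (i == e) && (z == linv y) || (i == d) && (z == y) then None else entry E i z.
Proof. by rewrite /=; case: andP => //; case: andP. Qed.

Lemma entry_erase E d y e i z j : entry (erase E d y e) i z = Some j ->
  [/\ entry E i z = Some j, ~~ ((i == e) && (z == linv y)) &
      ~~ ((i == d) && (z == y))].
Proof. by rewrite entry_eraseE; case: ifPn => //; rewrite negb_or => /andP[]. Qed.

Lemma coherent_erase E P d y e : coherent E P -> entry E d y = Some e ->
  coherent (erase E d y e) P.
Proof.
move=> I de; split; try by case: I.
- by move=> i z j /entry_erase[/(coh_row I)].
- move=> i z j /entry_erase[ij n1 n2]; have ji := coh_sym I ij.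
  rewrite entry_eraseE ji ifN // negb_or; apply/andP; split.
    apply: contra n2 => /andP[/eqP je /eqP /(can_inj (@linvK g)) zy].
    by move: ji; rewrite je zy (coh_sym I de) => -[<-]; rewrite !eqxx.
  apply: contra n1 => /andP[/eqP jd /eqP zy].
  move: ji; rewrite jd zy de => -[<-]; rewrite eqxx -zy linvK.
  by rewrite eqxx.
- by move=> i z j /entry_erase[/(coh_live I)].
- by move=> i z j /entry_erase[/(coh_tau_entry I)].
Qed.

Lemma rho_updateE E P i j : coherent E P ->
  rho (UPDATE E i) j = if j \in rho_orbit E i then REP E j else rho E j.
Proof. by move=> I /=; case: ifP => // /(REP_orbit (coh_rho_le I)) ->. Qed.

Lemma rho_update_fixed E P i j : coherent E P ->
  (rho (UPDATE E i) j == j) = (rho E j == j).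
Proof.
by move=> I; rewrite (rho_updateE _ _ I); case: ifP => // _;
  rewrite rho_fixedE //; apply: coh_rho_le I.
Qed.

Lemma coherent_update E P i : coherent E P -> coherent (UPDATE E i) P.
Proof.
move=> I; have r j := rho_updateE i j I; split; try by case: I.
- move=> j; rewrite r; case: ifP => _; last exact: coh_rho_le I j.
  exact: leq_trans (REP_le (coh_rho_le I) j) _.
- move=> j j0; rewrite r; case: ifP => _; last exact: coh_rho_gt0 I j j0.
  exact: REP_gt0 I j0.
- move=> j /(coh_rho_out I) rj; rewrite r; case: ifP => // _.
  exact: (REP_fixed (coh_rho_le I) rj).
- by move=> j z l; rewrite (rho_update_fixed _ _ I); apply: coh_live I _ _ _.
- by move=> d; rewrite (rho_update_fixed _ _ I); apply: coh_dead I _.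
- move=> j; rewrite r; case: ifP => _; [exact: tau_REP I|exact: coh_tau_rho I j].
Qed.

Lemma REP_update E P i : coherent E P -> REP (UPDATE E i) =1 REP E.
Proof.
move=> I j; apply/esym/REP_unique => [k|k|k].
- exact: coh_rho_le (coherent_update i I) k.
- rewrite (rho_updateE _ _ I); case: ifP => _.
    exact: REP_idem (coh_rho_le I) k.
  exact: REP_rho (coh_rho_le I) k.
- move/eqP; rewrite (rho_update_fixed _ _ I) => /eqP.
  by move/(REP_fixed (coh_rho_le I)).
Qed.

Lemma live_update E P i : coherent E P -> live (UPDATE E i) = live E.
Proof. by move=> I; apply: eq_filter => j; rewrite (rho_update_fixed _ _ I). Qed.

(** Merging two classes costs one live row, and puts one row in the queue. The
    pending rows are a parameter apart from the queue, because the row being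
    processed is pending and no longer queued. *)
Lemma MERGE_spec E P Q m n : coherent E P -> row E m -> row E n ->
  tau E m = tau E n ->
  exists E' s, [/\ MERGE (E, Q) m n = (E', Q ++ s),
    [/\ coherent E' (P ++ s), nrows E' = nrows E & entry E' = entry E],
    size (live E') + size s <= size (live E),
    forall i, REP E' (REP E i) = REP E' i & REP E' m = REP E' n].
Proof.
move=> I mE nE tmn; rewrite /MERGE.
case: eqP => [mn|/eqP mn].
  exists E, [::]; rewrite !cats0; split=> //; first by rewrite addn0.
  by move=> i; apply: REP_idem (coh_rho_le I) i.
set a := maxn _ _; set b := minn _ _; set E' := set_rho _ _.
exists E', [:: a]; rewrite cats1.
have lt_ba : b < a by rewrite /a /b; lia.
have aE : row E a by rewrite /a /maxn; case: ifP => _; rewrite (row_REP I).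
have bE : row E b by rewrite /b /minn; case: ifP => _; rewrite (row_REP I).
have ra : rho E a = a.
  by rewrite /a /maxn; case: ifP => _; apply: rho_REP (coh_rho_le I) _.
have rb : rho E b = b.
  by rewrite /b /minn; case: ifP => _; apply: rho_REP (coh_rho_le I) _.
have tab : tau E a = tau E b.
  by rewrite /a /b /maxn /minn; case: ifP => _; rewrite !(tau_REP _ I).
have r j : rho E' j = if j == a then b else rho E j by [].
have I' : coherent E' (P ++ [:: a]).
  split; try by case: I.
  - by move=> j; rewrite r; case: eqP => [->|_]; [apply: ltnW|apply: coh_rho_le I _].
  - move=> j j0; rewrite r; case: eqP => [_|_]; last exact: coh_rho_gt0 I j j0.
    by case/andP: bE.
  - move=> j jE; rewrite r; case: eqP => [ja|_]; last exact: coh_rho_out I j jE.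
    by move: aE jE; rewrite /row -ja /=; lia.
  - move=> j z l e; rewrite r mem_cat inE; case: (j == a); first by rewrite !orbT.
    by rewrite orbF; apply: coh_live I _ _ _ e.
  - move=> d; rewrite mem_cat inE r; case: (d =P a) => [->|_]; first by lia.
    by rewrite orbF; apply: coh_dead I d.
  - by move=> j; rewrite r; case: eqP => [->|_]; [exact/esym|apply: coh_tau_rho I j].
have RE j : REP E' j = if REP E j == a then b else REP E j.
  apply/esym; move: j; apply: REP_unique => [j|j|j]; first exact: coh_rho_le I' j.
    rewrite r; case: (j =P a) => [->|_]; last by rewrite (REP_rho (coh_rho_le I)).
    by rewrite !(REP_fixed (coh_rho_le I)) // eqxx; case: ifP.
  rewrite r; case: (j =P a) => [->|ne rj]; first by lia.
  by rewrite (REP_fixed (coh_rho_le I) rj); case: eqP.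
split=> //; last 1 first.
- by rewrite !RE /a /b /maxn /minn; case: ltnP => _; rewrite eqxx; case: eqP.
- have -> : live E' = rem a (live E).
    rewrite rem_filter ?filter_uniq ?iota_uniq // -filter_predI.
    apply: eq_filter => j /=; case: (j =P a) => [->|//].
    by rewrite ltn_eqF.
  have al : a \in live E by rewrite (mem_live _ I) aE ra eqxx.
  rewrite size_rem // addn1 prednK //.
  by case: (live E) al.
- by move=> j; rewrite !RE (REP_idem (coh_rho_le I)).
Qed.

End Operations.

(** * Coincidences *)

Section Coincidences.
Context {g : nat} {R : seq (primary g)}.
Implicit Types (E : table R) (i j k l m n d e : nat) (y z : letter g).
Implicit Types (P Q : seq nat).

(** What a coincidence step has to restore: of the entries of [E] only the two
    erased ones, [d^y = e] and its mirror image, can be missing in [E']. *)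
Lemma extends_erased E E' P d y e : coherent E P -> entry E d y = Some e ->
  nrows E' = nrows E -> (forall i, REP E' (REP E i) = REP E' i) ->
  (forall i z j, entry (erase E d y e) i z = Some j -> entry E' i z = Some j) ->
  class_entry E' d y e -> class_entry E' e (linv y) d -> extends E E'.
Proof.
move=> I de nE rE keep gde ged; split=> // [|i z j ij]; first by rewrite nE.
have [/andP[/eqP ie /eqP zy]|n1] := boolP ((i == e) && (z == linv y)).
  by move: ij; rewrite ie zy (coh_sym I de) => -[<-].
have [/andP[/eqP id /eqP zy]|n2] := boolP ((i == d) && (z == y)).
  by move: ij; rewrite id zy de => -[<-].
by apply/entry_class_entry/keep; rewrite entry_eraseE (negPf n1) (negPf n2).
Qed.

(** Whatever the case, the erased entry reappears between the classes of its
    ends: if [delta^y = f], then [f] is merged with [epsilon]; if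
    [epsilon^(y^-1) = f], then [f] is merged with [delta]; otherwise the entry
    is moved to the representatives. As [d] is dead it is neither [delta] nor
    [epsilon], so that it gets no entry back. *)
Lemma coincidence_step_spec E Q d y : coherent E (d :: Q) ->
  exists E' s, [/\ coincidence_step d (E, Q) y = (E', Q ++ s),
    [/\ coherent E' (d :: Q ++ s), nrows E' = nrows E & extends E E'],
    size (live E') + size s <= size (live E), entry E' d y = None
    & forall z, entry E d z = None -> entry E' d z = None].
Proof.
move=> I; rewrite /coincidence_step; case de: (entry E d y) => [e|]; last first.
  exists E, [::]; rewrite cats0 addn0; split=> //; split=> //.
  exact: extends_refl I.
rewrite -/(erase E d y e); set E1 := erase E d y e.
set E2 := UPDATE E1 d; set E3 := UPDATE E2 e.
have I1 : coherent E1 (d :: Q) := coherent_erase I de.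
have I2 : coherent E2 (d :: Q) := coherent_update d I1.
have I3 : coherent E3 (d :: Q) := coherent_update e I2.
have REP1 : REP E1 =1 REP E by apply: (eq_REP I).
have REP2 : REP E2 =1 REP E by move=> i; rewrite (REP_update _ I1).
have REP3 : REP E3 =1 REP E by move=> i; rewrite (REP_update _ I2).
have live3 : live E3 = live E.
  by rewrite (live_update _ I2) (live_update _ I1).
rewrite REP1 REP2; set delta := REP E d; set epsilon := REP E e.
have rho_le := coh_rho_le I.
have dE : row E d := coh_row I de; have eE : row E e := coh_row_target I de.
have deltaE : row E3 delta := row_REP I dE.
have epsilonE : row E3 epsilon := row_REP I eE.
have rdelta : rho E3 delta = delta.
  by apply/eqP; rewrite (rho_fixedE (coh_rho_le I3)) REP3 REP_idem.
have repsilon : rho E3 epsilon = epsilon.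
  by apply/eqP; rewrite (rho_fixedE (coh_rho_le I3)) REP3 REP_idem.
have d_dead : rho E3 d != d by apply: coh_dead I3 _ (mem_head _ _).
have d_delta : d != delta by apply: contraNneq d_dead => ->; apply/eqP.
have d_epsilon : d != epsilon by apply: contraNneq d_dead => ->; apply/eqP.
have tau3 i : tau E3 i = tau E i by [].
have tde : tau E e = omap (fun a => fp_act a y) (tau E d) := coh_tau_entry I de.
have ted : tau E d = omap (fun a => fp_act a (linv y)) (tau E e).
  exact: (coh_tau_entry I (coh_sym I de)).
have [td te] : tau E3 delta = tau E d /\ tau E3 epsilon = tau E e.
  by rewrite !tau3 !(tau_REP _ I).
have d0 z : z = y \/ entry E d z = None -> entry E3 d z = None.
  move=> zy; rewrite -[LHS]/(entry (erase E d y e) d z) entry_eraseE.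
  by case: orP zy => // n0 [zy|//]; case: n0; right; rewrite zy !eqxx.
case df: (entry E3 delta y) => [f|]; last case ed: (entry E3 epsilon (linv y)) => [f|].
- have tf : tau E3 epsilon = tau E3 f by rewrite (coh_tau_entry I3 df) td te.
  have [E' [s [-> [I' nE' eE'] size' REP' ef]]] :=
    MERGE_spec Q I3 epsilonE (coh_row_target I3 df) tf.
  have REP'E i : REP E' (REP E i) = REP E' i by rewrite -REP3.
  have e'E : REP E' f = REP E' e by rewrite -ef REP'E.
  exists E', s; rewrite -live3 eE'; split=> //;
    [split=> //|by apply: d0; left|by move=> z z0; apply: d0; right].
  apply: extends_erased I de _ _ _ _ _ => //; first by move=> i z j; rewrite eE'.
    by exists delta, f; rewrite eE' REP'E.
  by exists f, delta; rewrite eE' REP'E; split=> //; apply: coh_sym I3 _ _ _ df.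
- have tf : tau E3 delta = tau E3 f by rewrite (coh_tau_entry I3 ed) td te.
  have [E' [s [-> [I' nE' eE'] size' REP' ef]]] :=
    MERGE_spec Q I3 deltaE (coh_row_target I3 ed) tf.
  have REP'E i : REP E' (REP E i) = REP E' i by rewrite -REP3.
  have e'E : REP E' f = REP E' d by rewrite -ef REP'E.
  exists E', s; rewrite -live3 eE'; split=> //;
    [split=> //|by apply: d0; left|by move=> z z0; apply: d0; right].
  apply: extends_erased I de _ _ _ _ _ => //; first by move=> i z j; rewrite eE'.
    exists f, epsilon; rewrite eE' REP'E; split=> //.
    by rewrite -[y]linvK; apply: coh_sym I3 _ _ _ ed.
  by exists epsilon, f; rewrite eE' REP'E.
- set E' := DEDUCTION E3 delta y epsilon.
  have I' : coherent E' (d :: Q).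
    by apply: coherent_deduction; rewrite ?te ?td.
  have X := extends_deduction I3 df ed.
  have REP' i : REP E' i = REP E i := REP3 i.
  have d0' z : entry E3 d z = None -> entry E' d z = None.
    by rewrite entry_deductionE (negPf d_delta) (negPf d_epsilon).
  have deltaE' : entry E' delta y = Some epsilon.
    exact: entry_deduction.
  exists E', [::]; rewrite cats0 addn0 -live3; split=> //; first split=> //.
  + apply: extends_erased I de _ _ _ _ _ => //.
    * by move=> i; rewrite !REP' REP_idem.
    * move=> i z j e3; have {}e3 : entry E3 i z = Some j by [].
      rewrite entry_deductionE.
      case: andP => [[/eqP il /eqP zy]|_]; first by rewrite il zy ed in e3.
      by case: andP => [[/eqP ik /eqP zy]|//]; rewrite ik zy df in e3.
    * by exists delta, epsilon; rewrite !REP' !REP_idem.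
    * exists epsilon, delta; rewrite !REP' !REP_idem //; split=> //.
      exact: coh_sym I' _ _ _ deltaE'.
  + by apply/d0'/d0; left.
  + by move=> z z0; apply/d0'/d0; right.
Qed.

Lemma coincidence_steps_spec (L : seq (letter g)) E Q d : coherent E (d :: Q) ->
  exists E' s, [/\ foldl (coincidence_step d) (E, Q) L = (E', Q ++ s),
    [/\ coherent E' (d :: Q ++ s), nrows E' = nrows E & extends E E'],
    size (live E') + size s <= size (live E)
    & forall z, z \in L \/ entry E d z = None -> entry E' d z = None].
Proof.
elim: L E Q => [|y L IH] E Q I.
  exists E, [::]; rewrite cats0 addn0; split=> // [|z []//]; split=> //.
  exact: extends_refl I.
rewrite -[foldl _ _ (y :: L)]/(foldl _ (coincidence_step d (E, Q) y) L).
have [E1 [s1 [-> [I1 n1 X1] size1 y1 old1]]] := coincidence_step_spec y I.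
have [E2 [s2 [-> [I2 n2 X2] size2 old2]]] := IH _ _ I1.
exists E2, (s1 ++ s2); rewrite catA; split=> //.
- by rewrite n2 n1; split=> //; apply: extends_trans X1 X2.
- by rewrite size_cat; lia.
- move=> z zL; apply: old2; case: zL => [|/old1]; last by right.
  by rewrite inE => /orP[/eqP->|]; [right|left].
Qed.

Lemma coherent_processed E P d : coherent E (d :: P) ->
  (forall y, entry E d y = None) -> coherent E P.
Proof.
move=> I d0; split; try by case: I.
- move=> i y j e; have := coh_live I e; rewrite inE => /or3P[->//|/eqP id|->].
    by rewrite id d0 in e.
  by rewrite orbT.
- by move=> i iP; apply: coh_dead I _ _; rewrite inE iP orbT.
Qed.

(** Each processed row leaves the queue, and a row joins it only by dying: this
    is why the number of live rows plus the length of the queue is enough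
    fuel. *)
Lemma process_queue_spec (LC : seq (letter g)) n E Q :
  (forall y, y \in LC) -> coherent E Q -> size (live E) + size Q <= n ->
  exists E', [/\ process_queue LC n (E, Q) = Some E', coherent E' [::],
    nrows E' = nrows E & extends E E'].
Proof.
move=> LC_all; elim: n E Q => [|n IH] E [|d Q] I /= le_n.
- by exists E; split=> //; apply: extends_refl I.
- by move: le_n; rewrite /=; lia.
- by exists E; split=> //; apply: extends_refl I.
have [E1 [s [-> [I1 n1 X1] size1 d0]]] := coincidence_steps_spec LC I.
have {}I1 : coherent E1 (Q ++ s).
  by apply: coherent_processed I1 _ => y; apply: d0; left.
have [|E2 [e2 I2 n2 X2]] := IH _ _ I1; first by rewrite size_cat; lia.
by exists E2; rewrite n2 n1; split=> //; apply: extends_trans X1 X2.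
Qed.

Lemma COINCIDENCE_spec (LC : seq (letter g)) E m n :
  (forall y, y \in LC) -> coherent E [::] -> row E m -> row E n ->
  tau E m = tau E n ->
  exists fuel E', [/\ COINCIDENCE LC fuel E m n = Some E', coherent E' [::],
    nrows E' = nrows E, extends E E' & REP E' m = REP E' n].
Proof.
move=> LC_all I mE nE tmn; rewrite /COINCIDENCE.
have [E1 [s [-> [I1 n1 e1] _ REP1 mn1]]] := MERGE_spec [::] I mE nE tmn.
have X1 : extends E E1.
  split; [by rewrite n1|exact: REP1|].
  by move=> i y j; rewrite -e1; apply: entry_class_entry.
have [E2 [e2 I2 n2 X2]] := process_queue_spec LC_all I1 (leqnn _).
exists (size (live E1) + size s), E2; split; rewrite ?n2 //.
  exact: extends_trans X1 X2.
exact: extends_eqREP X2 mn1.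
Qed.

Lemma process_queue_mono (LC : seq (letter g)) n m EQ (E' : table R) : n <= m ->
  process_queue LC n EQ = Some E' -> process_queue LC m EQ = Some E'.
Proof.
elim: n m EQ => [|n IH] [|m] [E [|d Q]] //= nm; exact: IH.
Qed.

Lemma SCAN_mono (LC : seq (letter g)) n m E k w l E' : n <= m ->
  SCAN LC n E k w l = Some E' -> SCAN LC m E k w l = Some E'.
Proof.
elim: n m E k w l => [|n IH] [|m] //= E k w l nm.
case: (trace E k w) => k' w1; case: (trace E l _) => l' w2.
case: (winv w2) => [|y [|z w3]] //.
  by case: eqP => // _; apply: process_queue_mono.
exact: IH.
Qed.

End Coincidences.

(** * Scanning *)

Section Scanning.
Context {g : nat} {R : seq (primary g)}.
Implicit Types (E : table R) (i j k l m n d e : nat) (y z : letter g).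

Lemma trace_spec E k w k' w1 : coherent E [::] -> row E k -> rho E k = k ->
  trace E k w = (k', w1) -> [/\ row E k', rho E k' = k',
    exists2 w0, w = w0 ++ w1 & class_path E k w0 k' &
    if w1 is y :: _ then entry E k' y = None else True].
Proof.
move=> I; elim: w k => [|y w IH] k kE rk /=.
  by case=> <- <-; split=> //; exists [::].
case ky: (entry E k y) => [j|]; last by case=> <- <-; split=> //; exists [::].
have rj : rho E j = j.
  by have := coh_live I (coh_sym I ky); rewrite orbF => /eqP.
move/(IH _ (coh_row_target I ky) rj) => [k'E rk' [w0 -> p] stuck]; split=> //.
by exists (y :: w0) => //; exists j => //; apply: entry_class_entry.
Qed.

Lemma size_trace E k w : size (trace E k w).2 <= size w.
Proof.
elim: w k => //= y w IH k; case: (entry E k y) => [j|//].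
exact: leqW (IH j).
Qed.

(** Soundness alone would allow rows unrelated to the generators; that every row
    is reached from them is what later bounds the live rows. *)
Record well_formed E : Prop := WellFormed {
  wf_coherent : coherent E [::];
  wf_reached : forall i, row E i -> reached E i
}.

Lemma well_formed_extends E E' : well_formed E -> coherent E' [::] ->
  nrows E' = nrows E -> extends E E' -> well_formed E'.
Proof.
move=> G I' nE X; split=> // i; rewrite /row nE => iE.
exact: extends_reached X (wf_reached G iE).
Qed.

Lemma well_formed_define E i y : well_formed E -> row E i -> rho E i = i ->
  entry E i y = None -> well_formed (DEFINE E i y).
Proof.
move=> [I reachedE] iE ri iy; have X := extends_define I iE iy.
split; first exact: coherent_define.
move=> j; have [jE _|jN] := boolP (row E j).
  exact: extends_reached X (reachedE j jE).
have jy := entry_define E i y.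
move=> jE'; have -> : j = (nrows E).+1 by move: jN jE'; rewrite /row /=; lia.
exact: reached_entry (extends_reached X (reachedE i iE)) (entry_class_entry jy).
Qed.

Variable LC : seq (letter g).
Hypothesis LC_all : forall y, y \in LC.

(** The hypothesis on [tau] is the relation being scanned. It is inherited by
    the unread middle part of the word, and it justifies the deduction or the
    coincidence with which the scan ends. *)
Lemma SCAN_spec E k w l : well_formed E -> row E k -> row E l ->
  rho E k = k -> rho E l = l ->
  tau E l = omap (fun a => foldl (@fp_act g R) a w) (tau E k) ->
  exists fuel E', [/\ SCAN LC fuel E k w l = Some E', well_formed E',
    extends E E' & class_path E' k w l].
Proof.
(* A first pass may read nothing, so the length of the word alone does not
   decrease; after a definition the next letter can be read. *)
pose undef E k w := if w is y :: _ then entry E k y == None else false.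
have [n] := ubnP (size w + undef E k w).
elim: n E k w l => // n IH E k w l le_n G kE lE rk rl tkl.
have I := wf_coherent G.
case tr: (trace E k w) => [k' w1]; case tr': (trace E l (winv w1)) => [l' w2].
have [k'E rk' [w0 w_eq p] undef_k'] := trace_spec I kE rk tr.
have [l'E rl' [v0 v_eq q] undef_l'] := trace_spec I lE rl tr'.
have {}v_eq : w1 = winv w2 ++ winv v0.
  by rewrite -[w1]winvK v_eq /winv map_cat rev_cat.
have {q}q' := class_path_winv I q.
have tl' : tau E l' =
    omap (fun a => foldl (@fp_act g R) a (winv w2)) (tau E k').
  have := class_path_tau I (class_path_winv I q'); rewrite winvK => ->.
  rewrite tkl (class_path_tau I p) w_eq v_eq; case: (tau E k) => //= a.
  rewrite !foldl_cat; congr Some.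
  by rewrite -{2}[v0]winvK foldl_winv // => x y; apply: fp_actK.
have scanE fuel : SCAN LC fuel.+1 E k w l = match winv w2 with
    | [::] => if k' == l' then Some E else COINCIDENCE LC fuel E k' l'
    | [:: y] => Some (DEDUCTION E k' y l')
    | y :: w3 => SCAN LC fuel (DEFINE E k' y) k' (y :: w3) l'
    end by rewrite /= tr tr'.
have joined E' : extends E E' -> class_path E' k' (winv w2) l' -> class_path E' k w l.
  move=> X mid; rewrite w_eq v_eq.
  exact: class_path_cat (extends_class_path X p) (class_path_cat mid (extends_class_path X q')).
case mid: (winv w2) scanE joined tl' => [|y w3] scanE joined tl'.
  have [kl|kl] := eqVneq k' l'.
    exists 1, E; rewrite scanE kl eqxx; split=> //; first exact: extends_refl I.
    by apply: joined; [exact: extends_refl I|rewrite kl].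
  have tkl' : tau E k' = tau E l' by rewrite tl'; case: (tau E k').
  have [fuel [E' [e' I' n' X kl']]] := COINCIDENCE_spec LC_all I k'E l'E tkl'.
  exists fuel.+1, E'; rewrite scanE (negPf kl); split=> //.
    exact: well_formed_extends G I' n' X.
  exact: joined.
have k'y : entry E k' y = None by move: undef_k'; rewrite v_eq mid.
case: w3 mid scanE joined tl' => [|z w3] mid scanE joined tl'.
  have l'y : entry E l' (linv y) = None.
    by move: undef_l'; rewrite -[w2]winvK mid.
  exists 1, (DEDUCTION E k' y l'); rewrite scanE.
  have X := extends_deduction I k'y l'y.
  have I' : coherent (DEDUCTION E k' y l') [::] by apply: coherent_deduction.
  split=> //; first exact: well_formed_extends G I' _ X.
  apply: joined => //=; exists l' => //; apply: entry_class_entry.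
  exact: entry_deduction.
set E1 := DEFINE E k' y.
have G1 : well_formed E1 by apply: well_formed_define.
have X1 : extends E E1 := extends_define I k'E k'y.
have old i : row E i -> [/\ row E1 i, rho E1 i = rho E i & tau E1 i = tau E i].
  by rewrite /row /=; case: eqP => [->|_ iE]; [|split=> //]; lia.
have [k'1 rk'1 tk'1] := old _ k'E; have [l'1 rl'1 tl'1] := old _ l'E.
have defd : undef E1 k' [:: y, z & w3] = false.
  by rewrite /undef /E1 entry_define.
have le_mid : size [:: y, z & w3] + undef E1 k' [:: y, z & w3] < n.
  have le1 : size [:: y, z & w3] <= size w1 by rewrite v_eq mid size_cat leq_addr.
  have lt1 : size w1 < size w + undef E k w.
    have /= := size_trace E k w; rewrite tr /= /undef.
    case: w {le_n tkl w_eq scanE joined} tr => [|t v] /=.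
      by case=> _ w1_nil; move: le1; rewrite -w1_nil.
    case: (entry E k t) => [j tr _|_]; last by rewrite /= addn1 ltnS.
    by have := size_trace E j v; rewrite tr /= addn0 ltnS.
  by rewrite defd addn0; lia.
have tl1 : tau E1 l' =
    omap (fun a => foldl (@fp_act g R) a [:: y, z & w3]) (tau E1 k').
  by rewrite tk'1 tl'1 tl'.
have [fuel [E' [e' G' X' p']]] := IH _ _ _ _ le_mid G1 k'1 l'1
  (etrans rk'1 rk') (etrans rl'1 rl') tl1.
exists fuel.+1, E'; rewrite scanE; split=> //; first exact: extends_trans X1 X'.
by apply: joined => //; apply: extends_trans X1 X'.
Qed.

End Scanning.

(** * The turns of the main loop *)

Section Turns.
Context {g : nat} {R : seq (primary g)}.
Implicit Types (E : table R) (i j k l m n d e : nat) (y z : letter g).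

Lemma well_formed_init : well_formed (@INIT g R).
Proof.
have rowE i : row (@INIT g R) i -> exists s : 'I_g, i = gen_row s.
  by case: i => // i lt_ig; exists (Ordinal lt_ig).
split; first split=> //.
- by move=> _ /rowE[s ->] /=; rewrite insubT.
- by move=> s /=; rewrite valK.
- by move=> _ /rowE[s ->]; apply: reached_gen.
Qed.

Variables (LC LE : seq (letter g)) (R2 : seq (free_group g)).
Hypothesis LC_all : forall y, y \in LC.
Hypothesis LE_all : forall y, y \in LE.
Hypothesis R2_secondary : R2 =i [seq secondary r | r <- R].

Lemma scan_primary_mono n m (rs : seq (primary g)) E E' : n <= m ->
  scan_primary LC n E rs = Some E' -> scan_primary LC m E rs = Some E'.
Proof.
move=> nm; elim: rs E => //= -[[i u] j] rs IH E.
case e: (SCAN _ _ _ _ _ _) => [E1|] //=.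
by rewrite (SCAN_mono nm e) /=; apply: IH.
Qed.

Lemma scan_secondary_mono n m (ws : seq (free_group g)) E i E' : n <= m ->
  scan_secondary LC n E i ws = Some E' -> scan_secondary LC m E i ws = Some E'.
Proof.
move=> nm; elim: ws E => //= w ws IH E; case: ifP => // _.
case e: (SCAN _ _ _ _ _ _) => [E1|] //=.
by rewrite (SCAN_mono nm e) /=; apply: IH.
Qed.

Lemma main_loop_mono n m M E i (o : @outcome g R) : n <= m ->
  main_loop LC R2 LE n M E i = Some o -> main_loop LC R2 LE m M E i = Some o.
Proof.
elim: n m E i => [|n IH] [|m] //= E i nm; case: ifP => // _.
case e: (scan_secondary _ _ _ _ _) => [E1|] //=.
by rewrite (scan_secondary_mono (m := m) nm e) /=; apply: IH.
Qed.

Lemma scan_primary_spec (rs : seq (primary g)) E :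
  {subset rs <= R} -> well_formed E ->
  exists fuel E', [/\ scan_primary LC fuel E rs = Some E', well_formed E',
    extends E E' & forall (i : 'I_g) u (j : 'I_g),
      (i, u, j) \in rs -> class_path E' (gen_row i) u (gen_row j)].
Proof.
elim: rs E => [|[[i u] j] rs IH] E rsR G; have I := wf_coherent G.
  by exists 0, E; split=> //; apply: extends_refl I.
have rR : (i, u, j) \in R by apply: rsR; rewrite mem_head.
have rE (s : 'I_g) : row E (REP E (gen_row s)) := row_REP I (gen_row_row s I).
have r_rho (s : 'I_g) : rho E (REP E (gen_row s)) = REP E (gen_row s).
  exact: rho_REP (coh_rho_le I) _.
have ru : tau E (REP E (gen_row j)) = omap (fun a => foldl (@fp_act g R) a u)
    (tau E (REP E (gen_row i))).
  by rewrite !(tau_REP _ I) !(coh_tau_gen I) /= (fp_primary rR).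
have [f1 [E1 [e1 G1 X1 p1]]] :=
  SCAN_spec LC_all G (rE i) (rE j) (r_rho i) (r_rho j) ru.
have [|f2 [E2 [e2 G2 X2 p2]]] := IH E1 _ G1.
  by move=> r rrs; apply: rsR; rewrite inE rrs orbT.
exists (maxn f1 f2), E2; have X := extends_trans X1 X2; split=> //.
- rewrite /= (SCAN_mono (leq_maxl _ _) e1) /=.
  exact: scan_primary_mono (leq_maxr _ _) e2.
- move=> i' u' j'; rewrite inE => /orP[/eqP[-> -> ->]|]; last exact: p2.
  by apply: class_path_eq (extends_class_path X2 p1); rewrite (extends_REP X).
Qed.

Lemma scan_secondary_spec (ws : seq (free_group g)) E i :
  {subset ws <= R2} -> well_formed E ->
  exists fuel E', [/\ scan_secondary LC fuel E i ws = Some E', well_formed E',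
    extends E E', E' = E \/ i \in live E &
    i \in live E' -> forall w, w \in ws -> class_path E' i w i].
Proof.
elim: ws E => [|w ws IH] E wsR G; have I := wf_coherent G.
  by exists 0, E; split=> //; [apply: extends_refl I|left].
have [iE|iE] := boolP (i \in live E); last first.
  exists 0, E; rewrite /= (negPf iE); split=> //; first exact: extends_refl I.
  by left.
have /andP[rowi /eqP ri] : row E i && (rho E i == i) by rewrite -(mem_live _ I).
have tw : tau E i = omap (fun a => foldl (@fp_act g R) a w) (tau E i).
  have /mapP[r rR ->] : w \in [seq secondary r | r <- R].
    by rewrite -R2_secondary; apply/wsR/mem_head.
  by case: (tau E i) => //= a; rewrite fp_secondary.
have [f1 [E1 [e1 G1 X1 p1]]] := SCAN_spec LC_all G rowi rowi ri ri tw.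
have [|f2 [E2 [e2 G2 X2 _ p2]]] := IH E1 _ G1.
  by move=> v vws; apply: wsR; rewrite inE vws orbT.
exists (maxn f1 f2), E2; split=> //.
- rewrite /= iE (SCAN_mono (leq_maxl _ _) e1) /=.
  exact: scan_secondary_mono (leq_maxr _ _) e2.
- exact: extends_trans X1 X2.
- by right.
- move=> /p2 {}p2 v; rewrite inE => /orP[/eqP->|]; last exact: p2.
  exact: extends_class_path X2 p1.
Qed.

Definition filled E i := forall y, exists j, class_entry E i y j.

Lemma extends_filled E E' i : extends E E' -> filled E i -> filled E' i.
Proof. by move=> X f y; have [j ij] := f y; exists j; apply: extends_class_entry X ij. Qed.

Lemma filled_REP E i : coherent E [::] -> filled E (REP E i) -> filled E i.
Proof.
move=> I f y; have [j [i' [j' [ii' jj' e]]]] := f y; exists j, i', j'.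
by rewrite ii' (REP_idem (coh_rho_le I)).
Qed.

Lemma fill_row_spec E i : well_formed E ->
  [/\ well_formed (fill_row LE E i), extends E (fill_row LE E i) &
    i \in live E -> filled (fill_row LE E i) i].
Proof.
rewrite /fill_row => G; have I := wf_coherent G; rewrite (mem_live _ I).
case: andP => [[iE /eqP ri]|_]; last by split=> //; apply: extends_refl I.
set step := (X in foldl X _ _); suff fillL L :
    [/\ well_formed (foldl step E L), extends E (foldl step E L) &
    forall y, y \in L -> exists j, class_entry (foldl step E L) i y j].
  by have [? ? f] := fillL LE; split=> // _ y; apply/f/LE_all.
elim: L E G I iE ri => [|y L IH] E G I iE ri.
  by split=> //; apply: extends_refl I.
rewrite -[foldl _ _ _]/(foldl step (step E y) L) /(step E y).
case iy: (entry E i y) => [j|].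
  have [? X f] := IH _ G I iE ri; split=> // z.
  rewrite inE => /orP[/eqP->|]; last exact: f.
  by exists j; apply: extends_class_entry X (entry_class_entry iy).
have G1 := well_formed_define G iE ri iy; have X1 := extends_define I iE iy.
have [||G2 X2 f] := IH _ G1 (wf_coherent G1).
- by move: iE; rewrite /row /=; lia.
- by move: iE; rewrite /row /=; case: eqP => // ->; lia.
split=> // [|z]; first exact: extends_trans X1 X2.
rewrite inE => /orP[/eqP->|]; last exact: f.
exists (nrows E).+1; apply: extends_class_entry X2 _; apply: entry_class_entry.
exact: entry_define.
Qed.

(** The body of the main loop, freed from its fuel and from its bounds. *)
Definition turn E i E' : Prop := exists fuel E1,
  scan_secondary LC fuel E i R2 = Some E1 /\ E' = fill_row LE E1 i.

Lemma turn_functional E i E1 E2 : turn E i E1 -> turn E i E2 -> E1 = E2.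
Proof.
move=> [f1 [F1 [e1 ->]]] [f2 [F2 [e2 ->]]].
have := scan_secondary_mono (leq_maxl f1 f2) e1.
by rewrite (scan_secondary_mono (leq_maxr f1 f2) e2) => -[->].
Qed.

(** The first alternative makes a turn on a dead or missing row harmless: no row
    can appear behind the counter. A row that dies during its own turn is
    represented by a smaller one, which is already filled. *)
Lemma turn_spec E i : well_formed E ->
  exists E', [/\ turn E i E', well_formed E', extends E E' &
  [/\ E' = E \/ i \in live E,
    i \in live E' -> forall w, w \in R2 -> class_path E' i w i &
    (forall j, row E j -> j < i -> filled E j) ->
    forall j, row E' j -> j <= i -> filled E' j]].
Proof.
move=> G; have I := wf_coherent G.
have [f [E1 [e1 G1 X1 same1 p1]]] := scan_secondary_spec i (fun _ => id) G.
have I1 := wf_coherent G1; have [G2 X2 fill2] := fill_row_spec i G1.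
set E2 := fill_row LE E1 i in G2 X2 fill2 *.
have unchanged : i \notin live E1 -> E2 = E1.
  by rewrite /E2 /fill_row => /negPf->.
exists E2; split=> //; [by exists f, E1|exact: extends_trans X1 X2|].
have same : E2 = E \/ i \in live E.
  have [iE|iE] := boolP (i \in live E); [by right|left].
  by case: same1 iE => [<- iE|-> //]; apply: unchanged.
split=> //.
- have [/p1 p _ w /p|iE1] := boolP (i \in live E1); first exact: extends_class_path.
  by rewrite (unchanged iE1) (negPf iE1).
move=> fillE j jE2 le_ji.
have jE : row E j.
  case: same => [<- //|]; rewrite (mem_live _ I) => /andP[/andP[_ iE] _].
  by move: jE2; rewrite /row; lia.
have X := extends_trans X1 X2.
have [lt_ji|ge_ij] := ltnP j i; first exact: extends_filled X (fillE j jE lt_ji).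
have {ge_ij le_ji} ji : j = i by lia.
rewrite {j}ji in jE2 jE *.
have [/fill2 //|iE1] := boolP (i \in live E1).
have iE1r : row E1 i by move: jE (extends_nrows X1); rewrite /row; lia.
have lt_i : REP E1 i < i.
  rewrite ltn_neqAle REP_le ?andbT; last exact: coh_rho_le I1.
  by move: iE1; rewrite (mem_live _ I1) iE1r -(rho_fixedE (coh_rho_le I1)).
apply: extends_filled X2 _; apply: (filled_REP I1); apply: extends_filled X1 _.
apply: fillE => //; move: lt_i (row_REP I1 iE1r) jE; rewrite /row; lia.
Qed.

End Turns.

(** * The limit of an endless run *)

Section Eventually.

Definition eventually (P : nat -> Prop) := exists n0, forall n, n0 <= n -> P n.

Lemma eventually_and (P1 P2 : nat -> Prop) :
  eventually P1 -> eventually P2 -> eventually (fun n => P1 n /\ P2 n).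
Proof.
move=> [n1 p1] [n2 p2]; exists (maxn n1 n2) => n.
by rewrite geq_max => /andP[/p1 ? /p2 ?].
Qed.

Lemma eventually_all (T : eqType) (s : seq T) (P : T -> nat -> Prop) :
  (forall x, eventually (P x)) ->
  eventually (fun n => forall x, x \in s -> P x n).
Proof.
move=> evP; elim: s => [|x s IH]; first by exists 0.
have [n0 p] := eventually_and (evP x) IH; exists n0 => n /p[px ps] z.
by rewrite inE => /orP[/eqP->|/ps].
Qed.

Lemma eventually_ex (P : nat -> Prop) : eventually P -> exists n, P n.
Proof. by case=> n p; exists n; apply: p. Qed.

End Eventually.

Section Run.
Context {g : nat} {R : seq (primary g)}.
Implicit Types (i j k l m n : nat) (y z : letter g).
Variable run : nat -> table R.
Hypothesis run_well_formed : forall n, well_formed (run n).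
Hypothesis run_extendsS : forall n, extends (run n) (run n.+1).
Hypothesis run_filled : forall n j,
  row (run n) j -> j <= n -> filled (run n) j.
Hypothesis run_primary : forall (i : 'I_g) u (j : 'I_g), (i, u, j) \in R ->
  class_path (run 0) (gen_row i) u (gen_row j).
Hypothesis run_secondary : forall n i, i \in live (run n) -> i <= n ->
  forall r, r \in R -> class_path (run n) i (secondary r) i.

Let run_coherent n : coherent (run n) [::] := wf_coherent (run_well_formed n).

Lemma run_extends n m : n <= m -> extends (run n) (run m).
Proof.
move/subnKC <-; elim: (m - n) => [|d IH]; first by rewrite addn0; apply: extends_refl.
by rewrite addnS; apply: extends_trans IH (run_extendsS _).
Qed.

(** Representatives can only decrease. *)
Lemma REP_stabilizes k : exists v, eventually (fun n => REP (run n) k = v).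
Proof.
have [b] := ubnP (REP (run 0) k); elim: b {1}0 => // b IH n lt_b.
have [[m nm lt]|const] := pselect (exists2 m, n <= m & REP (run m) k < REP (run n) k).
  by apply: (IH m); lia.
exists (REP (run n) k), n => m nm; apply/eqP; rewrite eqn_leq.
rewrite (extends_REP_le k (run_coherent m) (run_extends nm)) leqNgt.
by apply/negP => lt; apply: const; exists m.
Qed.

Definition rep_lim k : nat := projT1 (cid (REP_stabilizes k)).

Lemma rep_limP k : eventually (fun n => REP (run n) k = rep_lim k).
Proof. by rewrite /rep_lim; case: cid. Qed.

Lemma rep_lim_from n k : exists2 m, n <= m & REP (run m) k = rep_lim k.
Proof.
by have [m p] := rep_limP k; exists (maxn n m); [apply: leq_maxl|apply/p/leq_maxr].
Qed.

Lemma rep_lim_eq n i j : REP (run n) i = REP (run n) j -> rep_lim i = rep_lim j.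
Proof.
move=> ij; have [m p] := eventually_and (rep_limP i) (rep_limP j).
have [<- <-] := p (maxn n m) (leq_maxr _ _).
exact: extends_eqREP (run_extends (leq_maxl n m)) ij.
Qed.

Lemma rep_lim_REP n i : rep_lim (REP (run n) i) = rep_lim i.
Proof. by apply: (@rep_lim_eq n); apply/REP_idem/coh_rho_le/run_coherent. Qed.

Lemma rep_limK k : rep_lim (rep_lim k) = rep_lim k.
Proof. by have [m _ e] := rep_lim_from 0 k; rewrite -{1}e rep_lim_REP. Qed.

Lemma rep_lim_le n k : rep_lim k <= REP (run n) k.
Proof.
have [m nm <-] := rep_lim_from n k; exact: extends_REP_le (run_coherent m) (run_extends nm).
Qed.

Definition arrow i y j : Prop := exists n, class_entry (run n) i y j.

Lemma arrow_from n i y j :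
  arrow i y j -> exists2 m, n <= m & class_entry (run m) i y j.
Proof.
case=> m ij; exists (maxn n m); first exact: leq_maxl.
exact: extends_class_entry (run_extends (leq_maxr n m)) ij.
Qed.

Lemma eventually_arrow i y j : arrow i y j ->
  eventually (fun n => entry (run n) (rep_lim i) y = Some (rep_lim j)).
Proof.
case=> m ij; have [n0 p] := eventually_and (rep_limP i) (rep_limP j).
exists (maxn m n0) => n; rewrite geq_max => /andP[mn /p[<- <-]].
by apply/class_entry_live => //; apply: extends_class_entry (run_extends mn) ij.
Qed.

(** In the limit a class has one target for each letter, because this is the
    case in each single table. *)
Lemma arrow_fun i i' y j j' : arrow i y j -> arrow i' y j' ->
  rep_lim i = rep_lim i' -> rep_lim j = rep_lim j'.
Proof.
move=> /eventually_arrow e /eventually_arrow e' ii'.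
have [n []] := eventually_ex (eventually_and e e').
by rewrite ii' => -> [].
Qed.

Lemma arrow_lim i y j : arrow i y j -> arrow (rep_lim i) y (rep_lim j).
Proof.
by move=> /eventually_arrow/eventually_ex[n ij]; exists n; apply: entry_class_entry.
Qed.

Lemma arrow_sym i y j : arrow i y j -> arrow j (linv y) i.
Proof. by case=> n ij; exists n; apply: class_entry_sym ij. Qed.

(** Row [i'] has been filled by turn [i'], whatever became of it since. *)
Lemma arrow_total i y j z : arrow i y j -> exists k, arrow i z k.
Proof.
case=> n [i' [j' [ii' _ /(coh_row (run_coherent n)) i'E]]].
have X := run_extends (leq_maxl n i').
have [|k [i2 [j2 [i2i' j2k e]]]] := run_filled _ (leq_maxr n i') z.
  by move: i'E (extends_nrows X); rewrite /row; lia.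
by exists k, (maxn n i'), i2, j2; rewrite i2i' (extends_eqREP X ii').
Qed.

(** Letters act on the stable rows. Extending the action by the identity to the
    other numbers keeps all its properties, and spares a type of stable rows. *)
Definition lim_act k y : nat :=
  if pselect (exists j, rep_lim k = k /\ arrow k y j) is left h
  then rep_lim (projT1 (cid h)) else k.

Lemma lim_act_arrow i y j : arrow i y j -> lim_act (rep_lim i) y = rep_lim j.
Proof.
move=> ij; rewrite /lim_act; case: pselect => [h|]; last first.
  by case; exists (rep_lim j); split; [apply: rep_limK|apply: arrow_lim].
by case: cid => k /= [ik ak]; apply: arrow_fun ak ij ik.
Qed.

Lemma lim_actK k y : lim_act (lim_act k y) (linv y) = k.
Proof.
rewrite {2}/lim_act; case: pselect => [h|no].
  by case: cid => j [/= rk /arrow_sym/lim_act_arrow->].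
rewrite /lim_act; case: pselect => // -[j [rk kj]].
by have [l kl] := arrow_total y kj; case: no; exists l.
Qed.

Lemma lim_act_path n i w j :
  class_path (run n) i w j -> foldl lim_act (rep_lim i) w = rep_lim j.
Proof.
elim: w i => [|y w IH] i /=; first exact: rep_lim_eq.
by case=> k ik /IH <-; rewrite (@lim_act_arrow i y k) //; exists n.
Qed.

(** A stable row [k] is live at turn [k], so the scan of [r] is not broken off,
    and the loop that it closes persists. *)
Lemma lim_act_secondary r k : r \in R -> fg_act lim_act k (secondary r) = k.
Proof.
move=> rR; have [[y [j [rk kj]]]|no] :=
  pselect (exists y j, rep_lim k = k /\ arrow k y j); last first.
  suff fixk (w : seq (letter g)) : foldl lim_act k w = k by apply: fixk.
  elim: w => //= y w IH; have -> // : lim_act k y = k.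
  by rewrite /lim_act; case: pselect => // -[j ?]; case: no; exists y, j.
have [n kn {}kj] := arrow_from k kj.
have nk : REP (run n) k = k.
  apply/eqP; rewrite eqn_leq (REP_le (coh_rho_le (run_coherent n))) /=.
  by have := rep_lim_le n k; rewrite rk.
move/(class_entry_live _ _ _ (run_coherent n)): kj; rewrite nk => kj.
rewrite -{1}rk -[RHS]rk; apply: (@lim_act_path n _ (secondary r)); apply: run_secondary => //.
rewrite (mem_live _ (run_coherent n)) (coh_row (run_coherent n) kj) /=.
by rewrite (rho_fixedE (coh_rho_le (run_coherent n))) nk.
Qed.

Lemma lim_act_primary (i : 'I_g) u (j : 'I_g) : (i, u, j) \in R ->
  fg_act lim_act (rep_lim (gen_row i)) u = rep_lim (gen_row j).
Proof. by move/run_primary/lim_act_path. Qed.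

Lemma rep_lim_orbit n j : reached (run n) j ->
  exists (s : 'I_g) w, rep_lim j = foldl lim_act (rep_lim (gen_row s)) w.
Proof.
elim=> [s k sk|i y k _ [s [w iw]] ik].
  by exists s, [::]; rewrite (rep_lim_eq sk).
exists s, (rcons w y); rewrite -cats1 foldl_cat -iw /=.
by apply/esym/lim_act_arrow; exists n.
Qed.

(** The image of the rack in the limit is bounded by some [N]. From the stage on
    at which the entries leaving the stable rows up to [N] have settled, a path
    from a generator never leaves them, so all live rows are stable and at most
    [N]. *)
Lemma finite_run_stops :
  finite_set [set: fp_rack R] -> exists n, max_live (run n) <= n.
Proof.
move=> finR; have [f fE] := fp_rack_eval lim_actK lim_act_primary lim_act_secondary.
have /finite_seqP[vals valsE] := finite_image f finR.
pose N := \max_(v <- vals) v.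
have lim_N n j : reached (run n) j -> rep_lim j <= N.
  move=> /rep_lim_orbit[s [w ->]]; rewrite -fE.
  have : f (foldl (fp_act (R:=R)) (fp_gen R s) w) \in vals.
    suff : [set` vals]%classic (f (foldl (fp_act (R:=R)) (fp_gen R s) w)) by [].
    by rewrite -valsE; exists (foldl (fp_act (R:=R)) (fp_gen R s) w).
  by move=> v_in; apply: leq_bigmax_seq.
have settled k y : eventually (fun n => forall j, rep_lim k = k -> arrow k y j ->
    entry (run n) k y = Some (rep_lim j)).
  have [[j [rk kj]]|no] := pselect (exists j, rep_lim k = k /\ arrow k y j).
    have [n0 p] := eventually_arrow kj; exists n0 => n /p; rewrite rk => e j' _ kj'.
    by rewrite e (arrow_fun kj kj').
  by exists 0 => n _ j rk kj; case: no; exists j.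
have settledN := eventually_all (iota 0 N.+1)
  (fun k => eventually_all (enum {: letter g}) (settled k)).
have gens := eventually_all (enum 'I_g) (fun s => rep_limP (gen_row s)).
have [n0 p] := eventually_and settledN gens.
exists (maxn n0 N); set n := maxn n0 N.
have [entries gens_n] := p n (leq_maxl _ _).
have reached_lim j : reached (run n) j -> REP (run n) j = rep_lim j.
  elim=> {j} [s j sj|i y j ri IH ij].
    by rewrite -sj gens_n ?mem_enum // (rep_lim_eq sj).
  have i_N : rep_lim i \in iota 0 N.+1 by rewrite mem_iota ltnS (lim_N n).
  have := entries _ i_N y (mem_enum _ y) (rep_lim j) (rep_limK i).
  rewrite rep_limK => /(_ (arrow_lim (ex_intro _ n ij))).
  by move/(class_entry_live _ _ _ (run_coherent n)): ij; rewrite IH => -> [].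
apply: leq_trans (leq_maxr n0 N); apply/bigmax_leqP_seq => j.
rewrite (mem_live _ (run_coherent n)) => /andP[jE /eqP rj] _.
have jR := wf_reached (run_well_formed n) jE.
rewrite -(REP_fixed (coh_rho_le (run_coherent n)) rj) reached_lim //.
exact: lim_N jR.
Qed.

End Run.

(** * Completion of the enumeration *)

Section Completion.
Context {g : nat} {R : seq (primary g)}.
Implicit Types (E : table R) (i j k l m n : nat) (y z : letter g).

Lemma max_live_le E n : coherent E [::] ->
  reflect (forall j, row E j -> rho E j = j -> j <= n) (max_live E <= n).
Proof.
move=> I; apply: (iffP idP) => [le_n j jE rj|le_n].
  apply: leq_trans le_n; apply: leq_bigmax_seq => //.
  by rewrite (mem_live _ I) jE rj eqxx.
apply/bigmax_leqP_seq => j; rewrite (mem_live _ I) => /andP[jE /eqP rj] _.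
exact: le_n.
Qed.

(** The elements [tau i] are stable under the letters, as all entries exist, and
    contain the generators, so every element of the rack is among them. *)
Lemma filled_finite E : coherent E [::] -> (forall i, row E i -> filled E i) ->
  finite_set [set: fp_rack R].
Proof.
move=> I fillE.
have surj i w : row E i -> exists2 j, row E j &
    tau E j = omap (fun a => foldl (@fp_act g R) a w) (tau E i).
  elim: w i => [|y w IH] i iE.
    by exists i => //; case: (tau E i).
  have [k ik] := fillE i iE y; have [i' [k' [_ kk' e]]] := ik.
  have k'E : row E k' := coh_row_target I e.
  have [j jE tj] := IH k' k'E; exists j => //; rewrite tj.
  rewrite -(tau_REP k' I) kk' (tau_REP k I) (class_entry_tau I ik).
  by case: (tau E i).
apply/finite_seqP; exists (pmap (tau E) (iota 1 (nrows E))).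
apply/seteqP; split=> // x _ /=; have [s [w ->]] := fp_rack_gen x.
have [j jE tj] := surj _ w (gen_row_row s I).
rewrite mem_pmap; apply/mapP; exists j; first by move: jE; rewrite /row mem_iota; lia.
by rewrite tj (coh_tau_gen I).
Qed.

Variables (LC LE : seq (letter g)) (R2 : seq (free_group g)).
Hypothesis LC_all : forall y, y \in LC.
Hypothesis LE_all : forall y, y \in LE.
Hypothesis R2_secondary : R2 =i [seq secondary r | r <- R].

(** The run continues after the main loop would have stopped; the turns are then
    idle, and this gives a sequence of tables that does not depend on [M]. *)
Definition next_table E i : table R :=
  if pselect (exists E', turn LC LE R2 E i E') is left h
  then projT1 (cid h) else E.

Fixpoint run E n : table R :=
  if n is n'.+1 then next_table (run E n') n else E.

Lemma next_tableP E i E' : turn LC LE R2 E i E' -> next_table E i = E'.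
Proof.
move=> t; rewrite /next_table; case: pselect => [h|[]]; last by exists E'.
by case: cid => E2 /= t2; apply: turn_functional t2 t.
Qed.

Lemma run_spec E : well_formed E -> forall n,
  [/\ well_formed (run E n), turn LC LE R2 (run E n) n.+1 (run E n.+1),
    extends (run E n) (run E n.+1),
    forall j, row (run E n) j -> j <= n -> filled (run E n) j &
    forall i, i \in live (run E n) -> i <= n ->
      forall r, r \in R -> class_path (run E n) i (secondary r) i].
Proof.
move=> G; have no0 E1 i : row E1 i -> i <= 0 -> False by rewrite /row; lia.
suff main n : [/\ well_formed (run E n),
    forall j, row (run E n) j -> j <= n -> filled (run E n) j &
    forall i, i \in live (run E n) -> i <= n ->
      forall r, r \in R -> class_path (run E n) i (secondary r) i].
  move=> n; have [Gn fn sn] := main n.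
  have [E' [t _ X _]] := turn_spec LC_all LE_all R2_secondary n.+1 Gn.
  by rewrite /= (next_tableP t).
elim: n => [|n [Gn fn sn]].
  split=> // [j jE /(no0 _ _ jE)//|i].
  by rewrite (mem_live _ (wf_coherent G)) => /andP[iE _] /(no0 _ _ iE).
have [E' [t G' X [same s' f']]] := turn_spec LC_all LE_all R2_secondary n.+1 Gn.
rewrite /= (next_tableP t); split=> // [|i iE' le_i r rR].
  by apply: f' => j jE lt_j; apply: fn.
have [lt_in|ge_in] := leqP i n; last first.
  have ei : i = n.+1 by lia.
  by rewrite ei in iE' *; apply: s' => //; rewrite R2_secondary map_f.
apply: (extends_class_path X); apply: sn => //.
have [I I'] := (wf_coherent Gn, wf_coherent G').
move: iE'; rewrite !(mem_live _ I') !(mem_live _ I) => /andP[iE' ri].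
apply/andP; split.
  case: same => [<- //|]; rewrite (mem_live _ I) => /andP[].
  by move: iE'; rewrite /row; lia.
rewrite (rho_fixedE (coh_rho_le I)) eqn_leq (REP_le (coh_rho_le I)) /=.
move: ri; rewrite (rho_fixedE (coh_rho_le I')) => /eqP {1}<-.
exact: extends_REP_le I' X.
Qed.

Lemma main_loop_complete E M n :
  well_formed E -> max_live (run E n) < n.+1 -> n < M ->
  exists fuel E', main_loop LC R2 LE fuel M E 1 = Some (Completed E').
Proof.
move=> G done nM; suff loop d m : m + d = n -> exists fuel E',
    main_loop LC R2 LE fuel M (run E m) m.+1 = Some (Completed E').
  exact: (loop n 0).
elim: d m => [|d IH] m md.
  exists 0, (run E m); move: done; rewrite -md addn0 /= => lt.
  by rewrite [m < _]ltnNge -ltnS lt.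
have [f [E' e']] := IH m.+1 (etrans (addSnnS m d) md).
have [_ [f1 [E1 [e1 eE1]]] _ _ _] := run_spec G m.
case live_m: ((m < max_live (run E m)) && (m < M)); last first.
  exists 0, (run E m); rewrite /= live_m; move/negbT: live_m.
  by rewrite negb_and -!leqNgt => /orP[le_m|]; [rewrite ltnS le_m|lia].
exists (maxn f f1).+1, E'; rewrite /= live_m.
rewrite (scan_secondary_mono (leq_maxr _ _) e1) /= -eE1.
exact: main_loop_mono (leq_maxl _ _) e'.
Qed.

Lemma main_loop_sound E M fuel E' : well_formed E ->
  main_loop LC R2 LE fuel M E 1 = Some (Completed E') ->
  exists n, max_live (run E n) <= n.
Proof.
move=> G; rewrite -[X in main_loop _ _ _ _ _ X]/(run E 0).
elim: fuel 0 => [|f IH] n /=; last case: ifP => _.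
- by case: ifP => // _; case: ifP => // lt _; exists n.
- have [_ [f1 [E1 [e1 eE1]]] _ _ _] := run_spec G n.
  case e: (scan_secondary _ _ _ _ _) => [E2|] //=.
  have := scan_secondary_mono (leq_maxl f f1) e.
  rewrite (scan_secondary_mono (leq_maxr f f1) e1) => -[<-].
  by rewrite -eE1; apply: IH.
- by case: ifP => // lt _; exists n.
Qed.

End Completion.

Local Open Scope classical_set_scope.

Theorem corollary4p4 (g : nat) (g_gt0 : 0 < g)
  (R : seq (primary g)) (uniq_R : uniq R)
  (R2 : seq (free_group g))
  (R2P : perm_eq R2 (undup [seq secondary r | r <- R]))
  (LC LE : seq (letter g))
  (LCP : perm_eq LC (enum {: letter g}))
  (LEP : perm_eq LE (enum {: letter g})) :
  finite_set [set: fp_rack R] <->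
  exists M : nat, 0 < M /\ completes R LC R2 LE M.
Proof.
have LC_all y : y \in LC by rewrite (perm_mem LCP) mem_enum.
have LE_all y : y \in LE by rewrite (perm_mem LEP) mem_enum.
have R2E : R2 =i [seq secondary r | r <- R].
  by move=> w; rewrite (perm_mem R2P) mem_undup.
have [f0 [E0 [e0 G0 _ p0]]] :=
  scan_primary_spec LC_all (fun _ => id) (@well_formed_init g R).
have run_E0 := run_spec LC_all LE_all R2E G0.
split=> [finR|[M [_ [fuel [E]]]]].
- have [n le_n] : exists n, max_live (run LC LE R2 E0 n) <= n.
    apply: finite_run_stops finR => [n|n|n|i u j|n].
    + by have [] := run_E0 n.
    + by have [] := run_E0 n.
    + by have [] := run_E0 n.
    + exact: p0.
    + by have [] := run_E0 n.
  have [f [E e]] := main_loop_complete LC_all LE_all R2E G0 le_n (leqnn n.+1).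
  exists n.+1; split=> //; exists (maxn f0 f), E; rewrite /ENUMERATE.
  rewrite (scan_primary_mono (leq_maxl _ _) e0) /=.
  exact: main_loop_mono (leq_maxr _ _) e.
- rewrite /ENUMERATE; case e: (scan_primary _ _ _ _) => [E1|] //=.
  have := scan_primary_mono (leq_maxl fuel f0) e.
  rewrite (scan_primary_mono (leq_maxr fuel f0) e0) => -[<-].
  case/(main_loop_sound LC_all LE_all R2E G0) => n le_n.
  have [Gn _ _ fn _] := run_E0 n; have I := wf_coherent Gn.
  apply: (filled_finite I) => i iE; apply: (filled_REP I); apply: fn.
    exact: row_REP I iE.
  apply: (elimT (max_live_le n I) le_n); first exact: row_REP I iE.
  exact: rho_REP (coh_rho_le I) i.
Qed.
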